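(* For each $n\in\mathbb{N}$ let $m=m(n)\ge4$ be an integer, let $\mathbf{p}^{(n)}=(p_x^{(n)})_{1\le x\le m(n)}$ be a probability mass function on $\{1,\dots,m(n)\}$ with all $p^{(n)}_x>0$, let $X_1,\dots,X_n$ be independent with probability mass function $\mathbf{p}^{(n)}$, and let $Y=Y(n)$ be the number of non-isolated balls, with standard deviation $\sigma_Y=\sigma_{Y(n)}$. Let $\gamma(n):=\max\left(n\sup_x p^{(n)}_x,1\right)$ and suppose $\sup_n\gamma(n)<\infty$. Then the following three conditions are equivalent: (1) $n^2\sum_x (p^{(n)}_x)^2\to\infty$ as $n\to\infty$; (2) $\sigma_Y\to\infty$ as $n\to\infty$; (3) $(Y-\mathbb{E}Y)/\sigma_Y$ converges in distribution to a standard normal random variable as $n\to\infty$. If these conditions hold, then, as $n\to\infty$, $$D_Y=\Theta(\sigma_Y^{-1})=\Theta\left(\left(n^2\sum_x (p^{(n)}_x)^2\right)^{-1/2}\right).$$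
   Context: For $1\le i\le n$ let $M_i:=-1+\sum_{j=1}^n\mathbf{1}\{X_j=X_i\}$ (the number of other balls in the same urn as ball $i$). The number of non-isolated balls is $Y:=\sum_{i=1}^n\mathbf{1}\{M_i>0\}$. For a random variable $W$ with finite mean $\mu_W$ and standard deviation $\sigma_W\in(0,\infty)$, $D_W:=\sup_{t\in\mathbb{R}}\left|P\left[\frac{W-\mu_W}{\sigma_W}\le t\right]-\Phi(t)\right|$, where $\Phi$ is the standard normal distribution function. For positive sequences, $a_n=\Theta(b_n)$ means that $a_n/b_n$ is bounded away from $0$ and $\infty$ for all large $n$. *)

(* Defs.v *)
From HB Require Import structures.
From mathcomp Require Import all_boot all_order all_algebra.
From mathcomp Require Import all_classical all_reals all_analysis.
From mathcomp Require Import measurable_realfun.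

Set Implicit Arguments.
Unset Strict Implicit.
Unset Printing Implicit Defensive.

Import Order.TTheory GRing.Theory Num.Theory.
Import numFieldNormedType.Exports.

Local Open Scope classical_set_scope.
Local Open Scope ring_scope.

Section random_variables.
Context d (T : measurableType d) (R : realType) (P : probability T R).

Definition mutually_independent d' (T' : measurableType d') (I : finType)
    (X : I -> {RV P >-> T'}) : Prop :=
  forall (J : {set I}) (A : I -> set T'),
    (forall i, measurable (A i)) ->
    P (\bigcap_(i in [set` J]) (X i @^-1` A i)) =
    (\prod_(i in J) P (X i @^-1` A i))%E.

Definition stddev (W : T -> R) : R := Num.sqrt (fine 'V_P[W]).

(* Since x / 0 = 0, this is the constant 0 when W has zero standard
   deviation. *)
Definition standardize (W : T -> R) (w : T) : R :=
  (W w - fine 'E_P[W]) / stddev W.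

Lemma measurable_standardize (W : {RV P >-> R}) :
  measurable_fun setT (standardize W).
Proof. by apply: measurable_funM => //; apply: measurable_funB. Qed.

HB.instance Definition _ (W : {RV P >-> R}) :=
  isMeasurableFun.Build _ _ _ _ (standardize W) (measurable_standardize W).

Definition Kolmogorov_dist_normal (W : {RV P >-> R}) : R :=
  sup (range (fun t : R =>
    `| fine (cdf (standardize W : {RV P >-> R}) t)
       - fine (normal_prob 0 1 `]-oo, t]) |)).

End random_variables.

(* The W n may live on different probability spaces; the limit is given by
   its law mu. *)
Definition cvg_in_distribution (R : realType) (d : nat -> measure_display)
    (T : forall n, measurableType (d n)) (P : forall n, probability (T n) R)
    (W : forall n, {RV (P n) >-> R})
    (mu : probability (measurableTypeR R) R) : Prop :=
  forall t : R, {for t, continuous (fun s : R => mu `]-oo, s]%classic)} ->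
    cdf (W n) t @[n --> \oo] --> mu `]-oo, t]%classic.

Lemma measurable_nat_comp2 d (T : measurableType d) (f g : T -> nat)
    (h : nat -> nat -> nat) :
  measurable_fun setT f -> measurable_fun setT g ->
  measurable_fun setT (fun w => h (f w) (g w)).
Proof.
move=> mf mg _ B _; rewrite setTI.
have -> : (fun w => h (f w) (g w)) @^-1` B = \bigcup_a \bigcup_(b in
    [set b | B (h a b)]) (f @^-1` [set a] `&` g @^-1` [set b]).
  apply/seteqP; split=> [w /= Bw|w [a _ [b /= Bab [/= -> ->]]] //].
  by exists (f w) => //; exists (g w).
apply: bigcupT_measurable => a; apply: bigcup_measurable => b _.
by apply: measurableI; rewrite -[X in measurable X]setTI; [exact: mf|exact: mg].
Qed.

(* X i is the label of the urn holding ball i. Labels are natural numbers rather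
   than elements of some 'I_m because a measurableType must be pointed. *)
Section urns.
Context d (T : measurableType d) (R : realType) (P : probability T R).
Context (n : nat) (X : 'I_n -> {RV P >-> nat}).

(* The term j = i contributes 1, so the predecessor is never truncated. *)
Definition nb_others (i : 'I_n) (w : T) : nat :=
  (\sum_(j < n) (X j w == X i w)).-1.

Definition non_isolated (w : T) : R :=
  (\sum_(i < n) (0 < nb_others i w))%N%:R.

Let measurable_nat_sum (F : 'I_n -> T -> nat) :
  (forall i, measurable_fun setT (F i)) ->
  measurable_fun setT (fun w => \sum_(i < n) F i w)%N.
Proof.
move=> mF; elim: (index_enum _) => [|i s ih].
  by under eq_fun do rewrite big_nil; exact: measurable_cst.
under eq_fun do rewrite big_cons.
exact: (measurable_nat_comp2 addn (mF i) ih).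
Qed.

Lemma measurable_non_isolated : measurable_fun setT non_isolated.
Proof.
apply: (@measurableT_comp _ _ _ T nat R (fun k : nat => k%:R)) => //.
apply: measurable_nat_sum => i.
apply: (measurable_nat_comp2 (fun a _ => (0 < a.-1)%N : nat) _
  (measurable_cst 0%N)).
apply: measurable_nat_sum => j.
exact: (measurable_nat_comp2 (fun a b => (a == b) : nat)).
Qed.

HB.instance Definition _ :=
  isMeasurableFun.Build _ _ _ _ non_isolated measurable_non_isolated.

End urns.

Definition isTheta (R : realType) (a b : R^nat) : Prop :=
  exists c C : R, 0 < c /\ \forall n \near \oo, c <= a n / b n <= C.

(* Main.v *)
From HB Require Import structures.
Require Import Defs.
From mathcomp Require Import all_boot all_order all_algebra.
From mathcomp Require Import all_classical all_reals all_analysis.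
From mathcomp Require Import measurable_realfun.
From mathcomp Require Import ring lra zify.

(* The law of Y depends only on the product law p^n, so probabilities become
   finite weighted sums Ex over configurations w : {ffun 'I_n -> U}.

   Upper bound on D_Y: redraw one ball i, from its urn a into an urn b of law p.
   Each occupancy count is a birth-and-death chain under this dynamics; if h_x
   solves the Stein equation of Bin(n, p_x) for k |-> k 1{k >= 2}, then
   F = h_a(N^i_a) - h_b(N^i_b), where N^i counts the balls other than i, is
   antisymmetric and its drift is exactly Y - E Y. Exchangeability and the Stein
   equation of the normal law bound D_Y by
   (sd (sum E[F Delta | w]) + 2 sd (sum E[F* Delta | w])) / Var Y, where Delta is
   the increment of Y and F* >= |F| is symmetric: as x f(x) and the indicator are
   monotone, the remainder of the Taylor expansion of the Stein solution f is
   itself an exchangeable-pair increment, so no concentration inequality is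
   needed. Efron-Stein bounds both variances by a constant times
   S = n^2 sum_x p_x^2, which is also an upper bound for Var Y.

   Lower bound on Var Y: match the urns in disjoint pairs {x, y}, in decreasing
   order of p. By Cauchy-Schwarz it suffices to exhibit, for each pair, a
   function correlated with Y and orthogonal to every function that does not
   separate x from y; exactly two balls in {x, y}, together or apart, does it.

   Lower bound on D_Y, and convergence in law implies sigma_Y -> oo: Y is
   integer-valued, so the distribution function of the standardized Y is flat on
   one of any two adjacent intervals of total length less than 1 / sigma_Y. *)

Set Implicit Arguments.
Unset Strict Implicit.
Unset Printing Implicit Defensive.

Import Order.TTheory GRing.Theory Num.Theory.
Import numFieldNormedType.Exports.

Local Open Scope classical_set_scope.
Local Open Scope ring_scope.

(** * Product expectations and the Efron-Stein inequality *)

Section product_expectation.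
Context (R : realType) (n : nat) (U : finType) (p : U -> R).
Implicit Types (w : {ffun 'I_n -> U}) (i j : 'I_n) (a b : U).
Implicit Types f g V : {ffun 'I_n -> U} -> R.

Definition upd w i a : {ffun 'I_n -> U} :=
  [ffun j => if j == i then a else w j].

Definition wt w : R := \prod_i p (w i).

Definition Ex f : R := \sum_w wt w * f w.

(** The conditional expectation of [f] given all coordinates but the [i]-th. *)
Definition avg i f w : R := \sum_a p a * f (upd w i a).

Lemma updE w i a j : upd w i a j = if j == i then a else w j.
Proof. by rewrite ffunE. Qed.

Lemma upd_same w i a : upd w i a i = a.
Proof. by rewrite updE eqxx. Qed.

Lemma upd_neq w i a j : j != i -> upd w i a j = w j.
Proof. by rewrite updE => /negbTE ->. Qed.

Lemma upd_id w i : upd w i (w i) = w.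
Proof. by apply/ffunP => j; rewrite updE; case: eqP => [->|]. Qed.

Lemma upd_upd w i a b : upd (upd w i a) i b = upd w i b.
Proof. by apply/ffunP => j; rewrite !updE; case: eqP. Qed.

Lemma upd_comm w i j a b : i != j ->
  upd (upd w i a) j b = upd (upd w j b) i a.
Proof.
move=> ij; apply/ffunP => k; rewrite !updE.
by case: (eqVneq k j) => [->|//]; rewrite eq_sym (negbTE ij).
Qed.

Lemma eq_Ex f g : f =1 g -> Ex f = Ex g.
Proof. by move=> fg; apply: eq_bigr => w _; rewrite fg. Qed.

Lemma ExD f g : Ex (fun w => f w + g w) = Ex f + Ex g.
Proof. by rewrite -big_split; apply: eq_bigr => w _; rewrite mulrDr. Qed.

Lemma ExN f : Ex (fun w => - f w) = - Ex f.
Proof. by rewrite -sumrN; apply: eq_bigr => w _; rewrite mulrN. Qed.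

Lemma ExB f g : Ex (fun w => f w - g w) = Ex f - Ex g.
Proof. by rewrite ExD ExN. Qed.

Lemma ExZ c f : Ex (fun w => c * f w) = c * Ex f.
Proof. by rewrite mulr_sumr; apply: eq_bigr => w _; rewrite mulrCA. Qed.

Lemma Ex_sum (J : Type) (r : seq J) (Q : pred J)
    (F : J -> {ffun 'I_n -> U} -> R) :
  Ex (fun w => \sum_(j <- r | Q j) F j w) = \sum_(j <- r | Q j) Ex (F j).
Proof.
by rewrite [RHS]exchange_big; apply: eq_bigr => w _; rewrite mulr_sumr.
Qed.

Hypothesis p_ge0 : forall a, 0 <= p a.
Hypothesis p_sum1 : \sum_a p a = 1.

Lemma wt_ge0 w : 0 <= wt w.
Proof. exact: prodr_ge0. Qed.

Lemma ler_Ex f g : (forall w, f w <= g w) -> Ex f <= Ex g.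
Proof.
by move=> fg; apply: ler_sum => w _; apply: ler_wpM2l; rewrite ?wt_ge0.
Qed.

Lemma Ex_ge0 f : (forall w, 0 <= f w) -> 0 <= Ex f.
Proof. by move=> f0; apply: sumr_ge0 => w _; rewrite mulr_ge0 ?wt_ge0. Qed.

Lemma Ex_prod (g : 'I_n -> U -> R) :
  Ex (fun w => \prod_i g i (w i)) = \prod_i \sum_a p a * g i a.
Proof.
by rewrite bigA_distr_bigA; apply: eq_bigr => w _; rewrite -big_split.
Qed.

Lemma Ex_cst c : Ex (fun=> c) = c.
Proof.
transitivity (c * Ex (fun w => \prod_(i < n) (fun=> fun=> 1) i (w i))).
  by rewrite -ExZ; apply: eq_Ex => w; rewrite big1_eq mulr1.
rewrite (Ex_prod (fun _ _ => 1)) big1 ?mulr1// => i _.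
by under eq_bigr do rewrite mulr1.
Qed.

(** Detailed balance: the product weight is reversible for the dynamics that redraws coordinate
    [i]. *)
Lemma wt_upd w i a : wt w * p a = wt (upd w i a) * p (w i).
Proof.
rewrite /wt (bigD1 i)//= [in RHS](bigD1 i)//= upd_same.
under [in RHS]eq_bigr => j ji do rewrite upd_neq//.
by rewrite mulrC mulrA [RHS]mulrAC.
Qed.

Lemma Ex_avg i f : Ex (avg i f) = Ex f.
Proof.
rewrite /Ex /avg.
transitivity (\sum_w \sum_a wt w * p a * f (upd w i a)).
  by apply: eq_bigr => w _; rewrite mulr_sumr; apply: eq_bigr => a _;
    rewrite mulrA.
rewrite pair_bigA /=.
(* The involution that swaps the coordinate [w i] with the fresh draw. *)
rewrite (reindex (fun x : {ffun 'I_n -> U} * U => (upd x.1 i x.2, x.1 i)))/=.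
  transitivity (\sum_(x : {ffun 'I_n -> U} * U) wt x.1 * p x.2 * f x.1).
    by apply: eq_bigr => -[w a] _ /=; rewrite upd_upd upd_id -wt_upd.
  rewrite -(pair_bigA _ (fun w a => wt w * p a * f w))/=.
  apply: eq_bigr => w _; rewrite -mulr_suml -mulr_sumr.
  by rewrite p_sum1 mulr1.
apply: onW_bij; exists (fun x => (upd x.1 i x.2, x.1 i)) => -[w a] /=.
all: by rewrite upd_upd upd_same upd_id.
Qed.

(** Exchangeability of the pair ([w], [upd w i b]): once coordinate [i] of [w] is averaged too, both
    sides are one double sum over two independent labels, taken in either order. *)
Lemma Ex_exchange i (K : {ffun 'I_n -> U} -> {ffun 'I_n -> U} -> R) :
  Ex (fun w => \sum_b p b * K w (upd w i b)) =
  Ex (fun w => \sum_b p b * K (upd w i b) w).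
Proof.
rewrite -(Ex_avg i) -[RHS](Ex_avg i); apply: eq_Ex => w; rewrite /avg.
under eq_bigr do rewrite mulr_sumr.
rewrite exchange_big /=; apply: eq_bigr => b _; rewrite mulr_sumr.
by apply: eq_bigr => a _; rewrite mulrCA !upd_upd.
Qed.

Lemma Ex_CS f g :
  Ex (fun w => f w * g w) ^+ 2 <=
  Ex (fun w => f w ^+ 2) * Ex (fun w => g w ^+ 2).
Proof.
set A := Ex (fun w => f w ^+ 2); set B := Ex (fun w => f w * g w).
set C := Ex (fun w => g w ^+ 2).
have A0 : 0 <= A by apply: Ex_ge0 => w; exact: sqr_ge0.
have quad x y : 0 <= x ^+ 2 * A + 2 * x * y * B + y ^+ 2 * C.
  rewrite -!ExZ -!ExD; apply: Ex_ge0 => w.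
  by rewrite (_ : _ + _ = (x * f w + y * g w) ^+ 2) ?sqr_ge0//; ring.
have [A_eq0|A_neq0] := eqVneq A 0.
  have [->|B_neq0] := eqVneq B 0; first by rewrite expr0n A_eq0 mul0r.
  (* With [A = 0] and [y = 1] the quadratic form is affine in [x]; this choice of [x] gives it the
     value -1. *)
  have := quad (- (C + 1) / (2 * B)) 1.
  rewrite A_eq0 (_ : _ + _ = -1) ?ler0N1//; field => //.
have A_gt0 : 0 < A by rewrite lt_neqAle eq_sym A_neq0.
have := quad (- B) A.
rewrite (_ : _ + _ = A * (A * C - B ^+ 2)); last by ring.
by rewrite pmulr_rge0// subr_ge0.
Qed.

Lemma Ex_sqr_le f : Ex f ^+ 2 <= Ex (fun w => f w ^+ 2).
Proof.
have := Ex_CS f (fun=> 1); rewrite expr1n Ex_cst mulr1.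
by rewrite (@eq_Ex (fun w => f w * 1) f)// => w; rewrite mulr1.
Qed.

Lemma Ex_norm_le f : Ex (fun w => `|f w|) <= Num.sqrt (Ex (fun w => f w ^+ 2)).
Proof.
rewrite -(@ler_sqr _ _ _)// ?nnegrE ?sqrtr_ge0//; last first.
  by apply: Ex_ge0 => w.
rewrite sqr_sqrtr; last by apply: Ex_ge0 => w; exact: sqr_ge0.
apply: le_trans (Ex_sqr_le _) _.
by apply: ler_Ex => w; rewrite real_normK ?num_real.
Qed.

Lemma norm_Ex_le f : `|Ex f| <= Ex (fun w => `|f w|).
Proof.
apply: le_trans (ler_norm_sum _ _ _) _.
by apply: ler_sum => w _; rewrite normrM ger0_norm ?wt_ge0.
Qed.

Definition Var f : R := Ex (fun w => (f w - Ex f) ^+ 2).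

Lemma Var_ge0 f : 0 <= Var f.
Proof. by apply: Ex_ge0 => w; exact: sqr_ge0. Qed.

Lemma VarE f : Var f = Ex (fun w => f w ^+ 2) - Ex f ^+ 2.
Proof.
rewrite /Var; set e := Ex f.
have -> : Ex (fun w => (f w - e) ^+ 2) =
    Ex (fun w => f w ^+ 2 - (2 * e * f w - e ^+ 2)).
  by apply: eq_Ex => w; ring.
rewrite ExB ExB ExZ Ex_cst -/e; ring.
Qed.

Definition avgs (s : seq 'I_n) f := foldr (fun i g => avg i g) f s.

Lemma avg_comm i j f w : i != j -> avg i (avg j f) w = avg j (avg i f) w.
Proof.
move=> ij; rewrite /avg.
under eq_bigr do rewrite mulr_sumr.
rewrite exchange_big /=; apply: eq_bigr => a _; rewrite mulr_sumr.
by apply: eq_bigr => b _; rewrite mulrCA upd_comm.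
Qed.

Lemma avg_upd i f w a : avg i f (upd w i a) = avg i f w.
Proof. by apply: eq_bigr => b _; rewrite upd_upd. Qed.

Lemma eq_avg i f g : f =1 g -> avg i f =1 avg i g.
Proof. by move=> fg w; apply: eq_bigr => a _; rewrite fg. Qed.

Lemma avgB i f g w : avg i (fun w => f w - g w) w = avg i f w - avg i g w.
Proof. by rewrite -sumrB; apply: eq_bigr => a _; rewrite mulrBr. Qed.

Lemma Ex_mul_avg i f g :
  Ex (fun w => f w * avg i g w) = Ex (fun w => avg i f w * avg i g w).
Proof.
rewrite -(Ex_avg i); apply: eq_Ex => w.
rewrite {1}/avg [in RHS]/avg mulr_suml; apply: eq_bigr => a _.
by rewrite avg_upd mulrA.
Qed.

Lemma Ex_avg_pythagoras i f :
  Ex (fun w => f w ^+ 2) =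
  Ex (fun w => (f w - avg i f w) ^+ 2) + Ex (fun w => avg i f w ^+ 2).
Proof.
have := Ex_mul_avg i f f => h.
transitivity (Ex (fun w => (f w - avg i f w) ^+ 2 +
   (2 * (f w * avg i f w) - avg i f w ^+ 2))).
  by apply: eq_Ex => w; ring.
rewrite ExD ExB ExZ h; congr (_ + _).
by rewrite -(@eq_Ex (fun w => avg i f w * avg i f w))// mulrDl mul1r addrK.
Qed.

Lemma Ex_avg_contract i f :
  Ex (fun w => avg i f w ^+ 2) <= Ex (fun w => f w ^+ 2).
Proof.
by rewrite (Ex_avg_pythagoras i f) lerDr; apply: Ex_ge0 => w; exact: sqr_ge0.
Qed.

Lemma Ex_avgs s f : Ex (avgs s f) = Ex f.
Proof. by elim: s => //= i s <-; rewrite Ex_avg. Qed.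

Lemma avgs_upd s i f w a : i \in s -> avgs s f (upd w i a) = avgs s f w.
Proof.
elim: s w => // j s ih w; rewrite inE => /orP[/eqP ->|si].
  exact: avg_upd.
have [->|ij] := eqVneq i j; first exact: avg_upd.
rewrite /= -/(avgs s f) /avg.
by apply: eq_bigr => b _; rewrite upd_comm// ih.
Qed.

Lemma upd_invariant_cst f : (forall w i a, f (upd w i a) = f w) ->
  forall w w', f w = f w'.
Proof.
move=> f_upd w w'.
(* Interpolates from [w] to [w'] one coordinate at a time. *)
pose h k := [ffun i : 'I_n => if (i < k)%N then w' i else w i].
have hP k : (k <= n)%N -> f (h k) = f w.
  elim: k => [_|k ih kn].
    by congr f; apply/ffunP => i; rewrite ffunE.
  rewrite -(ih (ltnW kn)) -[RHS](f_upd _ (Ordinal kn) (w' (Ordinal kn))).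
  congr f; apply/ffunP => i; rewrite !ffunE ltnS leq_eqVlt.
  have [->|] := eqVneq i (Ordinal kn); first by rewrite eqxx.
  by rewrite -val_eqE /= => /negbTE ->.
rewrite -(hP n)//; congr f; apply/ffunP => i.
by rewrite ffunE ltn_ord.
Qed.

Lemma avgs_enum f w : avgs (enum 'I_n) f w = Ex f.
Proof.
rewrite -(Ex_avgs (enum 'I_n) f).
transitivity (Ex (fun=> avgs (enum 'I_n) f w)); first by rewrite Ex_cst.
apply: eq_Ex => w'; apply: upd_invariant_cst => *.
by rewrite avgs_upd ?mem_enum.
Qed.

Lemma avgs_avg s i f : i \notin s -> avgs s (avg i f) =1 avg i (avgs s f).
Proof.
elim: s => //= j s ih; rewrite inE negb_or => /andP[ij si] w.
by rewrite (eq_avg _ (ih si)) avg_comm// eq_sym.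
Qed.

(** Pythagoras splits off one coordinate at a time. The averages commute, so a later term is the
    average over the removed coordinate of [f - avg j f], and averaging contracts the second
    moment. *)
Lemma avgs_var s f : uniq s ->
  Ex (fun w => f w ^+ 2) - Ex (fun w => avgs s f w ^+ 2) <=
  \sum_(i <- s) Ex (fun w => (f w - avg i f w) ^+ 2).
Proof.
elim: s f => [|i s ih] f; first by rewrite big_nil subrr.
move=> /=/andP[si us]; rewrite big_cons (Ex_avg_pythagoras i f) -addrA lerD2l.
have -> : Ex (fun w => avg i (avgs s f) w ^+ 2) =
    Ex (fun w => avgs s (avg i f) w ^+ 2).
  by apply: eq_Ex => w; rewrite avgs_avg.
apply: le_trans (ih _ us) _.
rewrite big_seq [leRHS]big_seq; apply: ler_sum => j sj.
have ij : i != j by apply: contraNneq si => ->.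
rewrite (_ : Ex _ = Ex (fun w => avg i (fun w => f w - avg j f w) w ^+ 2)).
  exact: Ex_avg_contract.
by apply: eq_Ex => w; rewrite avgB avg_comm// eq_sym.
Qed.

(** [avg i f] is the orthogonal projection of [f] on the functions that ignore coordinate [i]. *)
Lemma avg_best i f g : (forall w a, g (upd w i a) = g w) ->
  Ex (fun w => (f w - avg i f w) ^+ 2) <= Ex (fun w => (f w - g w) ^+ 2).
Proof.
move=> g_inv; rewrite [leRHS](Ex_avg_pythagoras i).
have avgg w : avg i g w = g w.
  by rewrite /avg; under eq_bigr do rewrite g_inv; rewrite -mulr_suml p_sum1 mul1r.
rewrite (_ : Ex _ = Ex (fun w =>
    (f w - g w - avg i (fun w => f w - g w) w) ^+ 2)).
  by rewrite lerDl; apply: Ex_ge0 => w; exact: sqr_ge0.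
by apply: eq_Ex => w; rewrite avgB avgg; congr (_ ^+ 2); ring.
Qed.

(** The [g i] stand in for the conditional expectations, so that in applications a ball can simply
    be deleted. *)
Lemma efron_stein f (g : 'I_n -> {ffun 'I_n -> U} -> R) :
  (forall i w a, g i (upd w i a) = g i w) ->
  Var f <= \sum_i Ex (fun w => (f w - g i w) ^+ 2).
Proof.
move=> g_inv; rewrite VarE.
rewrite (_ : Ex f ^+ 2 = Ex (fun w => avgs (enum 'I_n) f w ^+ 2)); last first.
  by rewrite -[LHS]Ex_cst; apply: eq_Ex => w; rewrite avgs_enum.
apply: le_trans (avgs_var _ (enum_uniq _)) _.
rewrite big_enum /=; apply: ler_sum => i _.
exact: avg_best.
Qed.

End product_expectation.

(** * Stein's equation for the normal law *)

Section real_derivatives.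
Context (R : realType).
Implicit Types (f g df : R -> R) (x y a b e A : R).

Lemma is_derive_mul f g x (df dg d : R) :
  is_derive x (1 : R) f df -> is_derive x (1 : R) g dg ->
  d = f x * dg + g x * df -> is_derive x (1 : R) (fun y => f y * g y) d.
Proof. by move=> Hf Hg ->; exact: (is_deriveM Hf Hg). Qed.

Lemma is_derive_sub f g x (df dg d : R) :
  is_derive x (1 : R) f df -> is_derive x (1 : R) g dg ->
  d = df - dg -> is_derive x (1 : R) (fun y => f y - g y) d.
Proof. by move=> Hf Hg ->; exact: (is_deriveB Hf Hg). Qed.

Lemma is_derive_inv f x (df d : R) : f x != 0 ->
  is_derive x (1 : R) f df ->
  d = - df / f x ^+ 2 -> is_derive x (1 : R) (fun y => (f y)^-1) d.
Proof.
move=> fx0 Hf ->; have := is_deriveV fx0 Hf.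
by congr is_derive; rewrite /GRing.scale/=; field.
Qed.

Lemma is_derive_csub (c : R) f x (df : R) :
  is_derive x (1 : R) f df -> is_derive x (1 : R) (fun y => c - f y) (- df).
Proof.
move=> Hf; apply: (is_derive_sub (is_derive_cst c x (1 : R)) Hf).
by rewrite sub0r.
Qed.

Lemma is_derive_MVT f df a b :
  (forall x, is_derive x (1 : R) f (df x)) -> a < b ->
  exists2 c, a < c < b & f b - f a = df c * (b - a).
Proof.
move=> fdf ab.
have cf : {within `[a, b], continuous f}.
  apply: continuous_subspaceT => x.
  exact/differentiable_continuous/derivable1_diffP.
have [c + fE] := MVT ab (fun x _ => fdf x) cf.
by rewrite in_itv => cab; exists c.
Qed.

Lemma is_derive_ge0_le f df :
  (forall x, is_derive x (1 : R) f (df x)) -> (forall x, 0 <= df x) ->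
  {homo f : x y / x <= y}.
Proof.
move=> fdf df0 x y; rewrite le_eqVlt => /predU1P[->//|xy].
have [c _ fxy] := is_derive_MVT fdf xy.
by rewrite -subr_ge0 fxy mulr_ge0// subr_ge0 ltW.
Qed.

Definition vanishes_pinfty f :=
  forall e, 0 < e -> exists A, forall x, A <= x -> `|f x| <= e.

Lemma vanishes_nonincreasing_ge0 f df x :
  (forall y, is_derive y (1 : R) f (df y)) -> (forall y, x <= y -> df y <= 0) ->
  vanishes_pinfty f -> 0 <= f x.
Proof.
move=> fdf df0 f_van; rewrite leNgt; apply/negP => fx0.
(* If [f x] were negative, [f] would stay below [f x] to the right of [x], too far from 0 for this
   tolerance. *)
have e0 : 0 < - f x / 2 by rewrite divr_gt0// oppr_gt0.
have [A /(_ (Num.max A x))] := f_van _ e0.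
rewrite le_max lexx => /(_ isT); apply/negP; rewrite -ltNge.
have h : f (Num.max A x) <= f x.
  have [|Ax] := leP A x; first by rewrite lexx.
  have [c /andP[xc _] fxA] := is_derive_MVT fdf Ax.
  rewrite -subr_le0 fxA mulr_le0_ge0 ?subr_ge0 ?(ltW Ax)//.
  exact/df0/ltW.
apply: (@lt_le_trans _ _ (- f (Num.max A x))); last first.
  by rewrite ler_normr lexx orbT.
apply: (@lt_le_trans _ _ (- f x)); last by rewrite lerN2.
rewrite ltr_pdivrMr// ltr_pMr ?oppr_gt0//.
by rewrite ltr1n.
Qed.

End real_derivatives.

(** * Bounds on the Mills ratio of a Gaussian tail *)

Section mills_ratio.
Context (R : realType) (Psi phi : R -> R) (M : R).
Hypothesis phi_gt0 : forall x, 0 < phi x.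
Hypothesis phi_ub : forall x, phi x <= M.
Hypothesis dPsi : forall x, is_derive x (1 : R) Psi (- phi x).
Hypothesis dphi : forall x, is_derive x (1 : R) phi (- (x * phi x)).
Hypothesis Psi_vanishes : vanishes_pinfty Psi.
Hypothesis phi_vanishes : vanishes_pinfty phi.

Let q (x : R) := 1 + x ^+ 2.

Let q_gt0 x : 0 < q x.
Proof. by rewrite ltr_pwDl// sqr_ge0. Qed.

Let dq x : is_derive x (1 : R) q (2 * x).
Proof.
have -> : q = (fun y => 1 - (- y) * y).
  by apply/funext => y; rewrite /q mulNr opprK.
rewrite -(opprK (2 * x)); apply: is_derive_csub.
apply: (is_derive_mul (is_deriveNid x 1) (is_derive_id x 1)); ring.
Qed.

Lemma tail_ge0 x : 0 <= Psi x.
Proof.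
apply: (vanishes_nonincreasing_ge0 dPsi) => // y _.
by rewrite oppr_le0 ltW.
Qed.

(** [Psi y - y * phi y / (1 + y ^+ 2)] has derivative [- 2 * phi y / (1 + y ^+ 2) ^+ 2] and vanishes
    at infinity, hence is nonnegative. The tail is abstract so as to cover both [1 - Phi x] and
    [Phi (- x)]. *)
Lemma mills_lower x : x * phi x <= (1 + x ^+ 2) * Psi x.
Proof.
pose k y := Psi y - y * (phi y * (q y)^-1).
have dk y : is_derive y (1 : R) k (- (2 * phi y / (q y) ^+ 2)).
  have dqV := is_derive_inv (lt0r_neq0 (q_gt0 y)) (dq y) erefl.
  have dphiV := is_derive_mul (dphi y) dqV erefl.
  apply: (is_derive_sub (dPsi y) (is_derive_mul (is_derive_id y 1) dphiV erefl)).
  by rewrite /q; field; exact: (lt0r_neq0 (q_gt0 y)).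
have k_van : vanishes_pinfty k.
  move=> e e0; have e2 : 0 < e / 2 by rewrite divr_gt0.
  have [A hA] := Psi_vanishes e2.
  have M0 : 0 <= M := le_trans (ltW (phi_gt0 0)) (phi_ub 0).
  (* The last two thresholds ensure [0 < y] and [y * M <= e / 2 * y ^+ 2], which bounds the second
     term of [k]. *)
  exists (Num.max A (Num.max 1 (M / (e / 2)))) => y.
  rewrite !ge_max => /and3P[Ay y1 My].
  have y0 : 0 < y by apply: lt_le_trans y1.
  rewrite (splitr e); apply: le_trans (ler_normB _ _) _.
  apply: lerD (hA _ Ay) _.
  rewrite ger0_norm; last by rewrite !mulr_ge0 ?invr_ge0 ?ltW.
  rewrite mulrA ler_pdivrMr//.
  apply: (@le_trans _ _ (y * M)); first by rewrite ler_wpM2l ?(ltW y0).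
  rewrite ler_pdivrMr// in My.
  apply: (@le_trans _ _ (e / 2 * y ^+ 2)).
    rewrite (_ : e / 2 * y ^+ 2 = y * (y * (e / 2))); last by ring.
    by rewrite ler_wpM2l ?(ltW y0).
  by rewrite ler_wpM2l ?ltW// /q ltrDr.
have : 0 <= k x.
  apply: (vanishes_nonincreasing_ge0 dk) => // y _.
  by rewrite oppr_le0 divr_ge0 ?mulr_ge0 ?exprn_ge0 ?ltW.
by rewrite subr_ge0 mulrA ler_pdivrMr// [_ * q x]mulrC.
Qed.

(** With [x] frozen, [phi y - x * Psi y] has derivative [(x - y) * phi y], nonpositive for [y >= x],
    and vanishes at infinity. *)
Lemma mills_upper x : x * Psi x <= phi x.
Proof.
pose s y := phi y - x * Psi y.
have ds y : is_derive y (1 : R) s ((x - y) * phi y).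
  apply: (is_derive_sub (dphi y)
    (is_derive_mul (is_derive_cst x y 1) (dPsi y) erefl)).
  by rewrite /cst/=; ring.
rewrite -subr_ge0; apply: (vanishes_nonincreasing_ge0 ds) => [y xy|].
  by rewrite mulr_le0_ge0 ?subr_le0 ?(ltW (phi_gt0 _)).
move=> e e0; have e2 : 0 < e / 2 by rewrite divr_gt0.
have x1 : 0 < `|x| + 1 by rewrite ltr_wpDl.
have [A hA] := phi_vanishes e2.
have [B hB] := Psi_vanishes (divr_gt0 e2 x1).
exists (Num.max A B) => y; rewrite ge_max => /andP[Ay By].
rewrite (splitr e); apply: le_trans (ler_normB _ _) (lerD (hA _ Ay) _).
rewrite normrM -(divfK (lt0r_neq0 x1) (e / 2)) [leRHS]mulrC.
by rewrite ler_pM// ?hB// lerDl.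
Qed.

End mills_ratio.

(** * The Stein solution for the indicator of a half-line *)

Section stein_equation.
Context (R : realType) (Phi phi : R -> R) (M : R).
Hypothesis phi_gt0 : forall x, 0 < phi x.
Hypothesis phi_ub : forall x, phi x <= M.
Hypothesis phiN : forall x, phi (- x) = phi x.
Hypothesis dPhi : forall x, is_derive x (1 : R) Phi (phi x).
Hypothesis dphi : forall x, is_derive x (1 : R) phi (- (x * phi x)).
Hypothesis Phi_pinfty : vanishes_pinfty (fun x => 1 - Phi x).
Hypothesis Phi_ninfty : vanishes_pinfty (fun x => Phi (- x)).
Hypothesis phi_vanishes : vanishes_pinfty phi.

Let dPsi x : is_derive x (1 : R) (fun x => 1 - Phi x) (- phi x).
Proof.
exact: is_derive_csub.
Qed.

Let dPhiN x : is_derive x (1 : R) (fun x => Phi (- x)) (- phi x).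
Proof.
have -> : (fun x => Phi (- x)) = Phi \o -%R by apply/funext.
by apply: is_derive_eq; rewrite phiN mulrN1.
Qed.

Let Phi_ge0 x : 0 <= Phi x.
Proof. by rewrite -(opprK x); apply: (tail_ge0 phi_gt0 dPhiN). Qed.

Let Phi_le1 x : Phi x <= 1.
Proof. by rewrite -subr_ge0; apply: (tail_ge0 phi_gt0 dPsi). Qed.

Let L x := Phi x / phi x.
Let U x := (1 - Phi x) / phi x.

Let phi_neq0 x : phi x != 0. Proof. by rewrite lt0r_neq0. Qed.

Let dL x : is_derive x (1 : R) L (1 + x * L x).
Proof.
have dphiV := is_derive_inv (phi_neq0 x) (dphi x) erefl.
by apply: (is_derive_mul (dPhi x) dphiV); rewrite /L; field.
Qed.

Let dU x : is_derive x (1 : R) U (x * U x - 1).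
Proof.
have dphiV := is_derive_inv (phi_neq0 x) (dphi x) erefl.
by apply: (is_derive_mul (dPsi x) dphiV); rewrite /U; field.
Qed.

(** The numerator of the derivative is nonnegative by the lower Mills bound for the left tail, taken
    at [- x]. *)
Let xL_nd : {homo (fun x => x * L x) : x y / x <= y}.
Proof.
apply: (@is_derive_ge0_le _ _ (fun x => L x + x * (1 + x * L x))) => x.
  by apply: (is_derive_mul (is_derive_id x 1) (dL x)); rewrite /=; ring.
have := mills_lower phi_gt0 phi_ub dPhiN dphi Phi_ninfty (- x).
rewrite phiN opprK sqrrN => h.
rewrite (_ : _ + _ = ((1 + x ^+ 2) * Phi x - - x * phi x) / phi x).
  by rewrite divr_ge0 ?(ltW (phi_gt0 _))// subr_ge0.
by rewrite /L; field.
Qed.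

Let xU_nd : {homo (fun x => x * U x) : x y / x <= y}.
Proof.
apply: (@is_derive_ge0_le _ _ (fun x => U x + x * (x * U x - 1))) => x.
  by apply: (is_derive_mul (is_derive_id x 1) (dU x)); rewrite /=; ring.
have h := mills_lower phi_gt0 phi_ub dPsi dphi Phi_pinfty x.
rewrite (_ : U x + _ = ((1 + x ^+ 2) * (1 - Phi x) - x * phi x) / phi x).
  by rewrite divr_ge0 ?(ltW (phi_gt0 _))// subr_ge0.
by rewrite /U; field.
Qed.

Let xL_ge x : -1 <= x * L x.
Proof.
rewrite /L mulrA ler_pdivlMr// mulN1r lerNl -mulNr.
by have := mills_upper phi_gt0 dPhiN dphi Phi_ninfty phi_vanishes (- x);
  rewrite phiN opprK.
Qed.

Let xU_le x : x * U x <= 1.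
Proof.
rewrite /U mulrA ler_pdivrMr// mul1r.
exact: (mills_upper phi_gt0 dPsi dphi Phi_pinfty phi_vanishes).
Qed.

Definition step (z x : R) : R := (x <= z)%R%:R.

Lemma step_noninc z : {homo step z : x y / x <= y >-> y <= x}.
Proof.
move=> x y xy; rewrite /step ler_nat.
by case: (leP y z) => // yz; rewrite (le_trans xy yz).
Qed.

Lemma step_itv z x : 0 <= step z x <= 1.
Proof. by rewrite /step ler0n lern1; case: leP. Qed.

(* The bounded solution of f'(x) - x f(x) = step z x - Phi z. *)
Definition stein_sol z x := if x <= z then (1 - Phi z) * L x else Phi z * U x.

Let stein_right z x : z <= x -> stein_sol z x = Phi z * U x.
Proof.
rewrite /stein_sol le_eqVlt => /predU1P[->|]; last by case: ltP.
by rewrite lexx /L /U mulrCA mulrA.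
Qed.

Let g z x := x * stein_sol z x.

(** On either side of [z], [g z] is a nonnegative multiple of [x * L x] or of [x * U x], both
    nondecreasing, and the two formulas agree at [z]. *)
Lemma stein_nd z : {homo g z : x y / x <= y}.
Proof.
have nl x y : x <= y -> y <= z -> g z x <= g z y.
  move=> xy yz; rewrite /g /stein_sol yz (le_trans xy yz).
  by rewrite mulrCA [leRHS]mulrCA ler_wpM2l ?subr_ge0 ?xL_nd.
have nr x y : x <= y -> z <= x -> g z x <= g z y.
  move=> xy zx; rewrite /g !stein_right ?(le_trans zx)//.
  by rewrite mulrCA [leRHS]mulrCA ler_wpM2l ?xU_nd.
move=> x y xy; have [yz|zy] := leP y z; first exact: nl.
have [xz|zx] := leP x z; last by apply: nr => //; exact: ltW.
by apply: (@le_trans _ _ (g z z)); [exact: nl|apply: nr => //; exact: ltW].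
Qed.

(** By monotonicity it suffices to bound [g z] from below to the left of [z] and from above to the
    right, where the upper Mills bound applies. *)
Lemma stein_norm_le z x : `|g z x| <= 1.
Proof.
have lo y : y <= z -> -1 <= g z y.
  move=> yz; rewrite /g /stein_sol yz mulrCA.
  apply: (@le_trans _ _ ((1 - Phi z) * -1)); last first.
    by rewrite ler_wpM2l ?subr_ge0 ?xL_ge.
  by rewrite mulrN1 lerN2 lerBlDr lerDl.
have up y : z <= y -> g z y <= 1.
  move=> zy; rewrite /g stein_right// mulrCA.
  apply: (@le_trans _ _ (Phi z * 1)); last by rewrite mulr1.
  by rewrite ler_wpM2l ?xU_le.
rewrite ler_norml; apply/andP; split.
  have [xz|zx] := leP x z; first exact: lo.
  by apply: (@le_trans _ _ (g z z)); [exact: lo|apply/stein_nd/ltW].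
have [xz|zx] := leP x z; last exact/up/ltW.
by apply: (@le_trans _ _ (g z z)); [exact: stein_nd|exact: up].
Qed.

Let incr_left z a b : a <= b -> b <= z ->
  (b - a) * (g z a + 1 - Phi z) <= stein_sol z b - stein_sol z a
    <= (b - a) * (g z b + 1 - Phi z).
Proof.
rewrite le_eqVlt => /predU1P[->|ab bz]; first by rewrite !subrr !mul0r lexx.
rewrite /g /stein_sol bz (le_trans (ltW ab) bz) -mulrBr.
have [c /andP[ac cb] ->] := is_derive_MVT dL ab.
have E y : (b - a) * (y * ((1 - Phi z) * L y) + 1 - Phi z) =
    (1 - Phi z) * ((1 + y * L y) * (b - a)) by ring.
rewrite !E; apply/andP; split; apply: ler_wpM2l; rewrite ?subr_ge0//.
all: by rewrite ler_pM2r ?subr_gt0// lerD2l; apply: xL_nd; exact: ltW.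
Qed.

Let incr_right z a b : a <= b -> z <= a ->
  (b - a) * (g z a - Phi z) <= stein_sol z b - stein_sol z a
    <= (b - a) * (g z b - Phi z).
Proof.
rewrite le_eqVlt => /predU1P[->|ab za]; first by rewrite !subrr !mul0r lexx.
have zb := le_trans za (ltW ab).
rewrite /g !stein_right// -mulrBr.
have [c /andP[ac cb] ->] := is_derive_MVT dU ab.
have E y : (b - a) * (y * (Phi z * U y) - Phi z) =
    Phi z * ((y * U y - 1) * (b - a)) by ring.
rewrite !E; apply/andP; split; apply: ler_wpM2l => //.
all: by rewrite ler_pM2r ?subr_gt0// lerD2r; apply: xU_nd; exact: ltW.
Qed.

(** Away from [z] the derivative is [g z + step z - Phi z] with [g z] monotone, so the mean value
    theorem gives both bounds; an interval that straddles [z] is cut at [z]. *)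
Let incr z a b : a <= b ->
  (b - a) * (g z a + step z b - Phi z) <= stein_sol z b - stein_sol z a
    <= (b - a) * (g z b + step z a - Phi z).
Proof.
move=> ab; have ba : 0 <= b - a by rewrite subr_ge0.
have [bz|zb] := leP b z.
  by rewrite /step bz (le_trans ab bz); exact: incr_left.
have [za|az] := leP z a.
  have /andP[h1 h2] := incr_right ab za.
  have -> : step z b = 0 by rewrite /step leNgt zb.
  rewrite addr0 h1 (le_trans h2)// ler_wpM2l// lerD2r lerDl.
  by have /andP[] := step_itv z a.
have -> : step z b = 0 by rewrite /step leNgt zb.
have -> : step z a = 1 by rewrite /step (ltW az).
rewrite addr0.
have /andP[h1 h2] := incr_left (ltW az) (lexx z).
have /andP[h3 h4] := incr_right (ltW zb) (lexx z).
have gaz := stein_nd z (ltW az); have gzb := stein_nd z (ltW zb).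
rewrite -!/(g _ _) in gaz gzb.
apply/andP; split; nra.
Qed.

(** The remainder is controlled by increments of the monotone functions [g z] and [step z], not by a
    second derivative. *)
Lemma stein_increment z x y :
  `|stein_sol z x - stein_sol z y
    - (x - y) * (g z x + step z x - Phi z)| <=
  (x - y) * (g z x - g z y) + (x - y) * (step z y - step z x).
Proof.
have p1 : 0 <= (x - y) * (g z x - g z y).
  have [xy|yx] := leP x y; last first.
    by rewrite mulr_ge0 ?subr_ge0 ?(ltW yx)//; apply/stein_nd/ltW.
  by rewrite mulr_le0 ?subr_le0//; exact: stein_nd.
have p2 : 0 <= (x - y) * (step z y - step z x).
  have [xy|yx] := leP x y; last first.
    by rewrite mulr_ge0 ?subr_ge0 ?(ltW yx)//; apply/step_noninc/ltW.
  by rewrite mulr_le0 ?subr_le0//; exact: step_noninc.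
rewrite ler_norml; have [xy|yx] := leP x y.
  have /andP[h1 h2] := incr z xy.
  by apply/andP; split; lra.
have /andP[h1 h2] := incr z (ltW yx).
by apply/andP; split; lra.
Qed.

End stein_equation.


(** * The standard normal distribution function and density *)

Section standard_normal.
Context (R : realType).

Definition Phi (t : R) : R := fine (normal_prob 0 1 `]-oo, t]).
Definition gauss (t : R) : R := normal_pdf 0 1 t.

Lemma gaussE t : gauss t = normal_peak 1 * expR (- t ^+ 2 / 2).
Proof.
rewrite /gauss normal_pdfE ?oner_eq0// /normal_fun.
by rewrite subr0 expr1n.
Qed.

Lemma gauss_gt0 t : 0 < gauss t.
Proof. by rewrite gaussE mulr_gt0 ?normal_peak_gt0 ?oner_eq0 ?expR_gt0. Qed.

Lemma gauss_ub t : gauss t <= normal_peak 1.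
Proof. by apply: normal_pdf_ub; rewrite oner_eq0. Qed.

Lemma gaussN t : gauss (- t) = gauss t.
Proof. by rewrite !gaussE sqrrN. Qed.

Lemma gauss_derive t : is_derive t (1 : R) gauss (- (t * gauss t)).
Proof.
have -> : gauss = (fun t => normal_peak 1 * expR (- t ^+ 2 / 2)).
  by apply/funext => ?; exact: gaussE.
have d1 : is_derive t (1 : R) (fun t : R => - t ^+ 2 / 2) (- t).
  rewrite (_ : (fun t => _) = (fun t : R => (- 2^-1 * t) * t)); last first.
    by apply/funext => s; field.
  have d0 := is_derive_mul (is_derive_cst (- 2^-1 : R) t 1) (is_derive_id t 1) erefl.
  by apply: (is_derive_mul d0 (is_derive_id t 1)); rewrite /cst/=; field.
have d2 := is_derive1_comp (is_derive_expR _) d1.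
apply: (is_derive_mul (is_derive_cst (normal_peak 1) t (1 : R)) d2).
by rewrite /cst/=; ring.
Qed.

Lemma Phi_derive t : is_derive t (1 : R) Phi (gauss t).
Proof.
have ltt1 : t < t + 1 by rewrite ltrDl.
have int : lebesgue_measure.-integrable [set` `]-oo, (t + 1)]] (EFin \o gauss).
  apply: (integrableS measurableT) => //.
  exact: integrable_normal_pdf.
have cont : {for t, continuous gauss}.
  by apply: continuous_normal_pdf; rewrite oner_eq0.
have [d1 d2] := continuous_FTC1 ltt1 int (ltNyr t) cont.
have dP : derivable Phi t 1 := d1.
have dE : derive1 Phi t = gauss t := d2.
by apply: (DeriveDef dP); rewrite -derive1E.
Qed.

(** The identity as a random variable under the normal law: its cdf is [Phi], which gives the limits
    of [Phi] at both infinities. *)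
Let idN : measurableTypeR R -> R := idfun.

Let measurable_idN : measurable_fun setT idN.
Proof. exact: measurable_id. Qed.

HB.instance Definition _ := isMeasurableFun.Build _ _ _ _ idN measurable_idN.

Let Phi_cdf t :
  cdf (idN : {RV (normal_prob 0 1 : probability _ R) >-> R}) t = (Phi t)%:E.
Proof.
rewrite /cdf /distribution /pushforward/= /idN preimage_id /Phi fineK//.
exact: fin_num_measure.
Qed.

Lemma Phi_ninfty : vanishes_pinfty (fun x => Phi (- x)).
Proof.
have := cvg_cdfNy0 (idN : {RV (normal_prob 0 1 : probability _ R) >-> R}).
move=> /fine_cvgP[_ /cvgrPdist_le h] e e0.
have [M [_ hM]] := h e e0.
exists (1 - M) => x Mx.
have := hM (- x); rewrite /comp sub0r normrN Phi_cdf; apply.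
by rewrite ltrNl; apply: lt_le_trans Mx; rewrite ltrDr.
Qed.

Lemma Phi_pinfty : vanishes_pinfty (fun x => 1 - Phi x).
Proof.
have := cvg_cdfy1 (idN : {RV (normal_prob 0 1 : probability _ R) >-> R}).
move=> /fine_cvgP[_ /cvgrPdist_le h] e e0.
have [M [_ hM]] := h e e0.
exists (1 + M) => x Mx.
have := hM x; rewrite /comp Phi_cdf; apply.
by apply: lt_le_trans Mx; rewrite ltrDr.
Qed.

Lemma gauss_vanishes : vanishes_pinfty gauss.
Proof.
move=> e e0; pose K := normal_peak 1 : R.
have K0 : 0 < K by rewrite normal_peak_gt0 ?oner_eq0.
(* By [expR_ge1Dx] it suffices that [2 * K / e <= x ^+ 2]; the added 2 makes [x >= 1], so that
   [x <= x ^+ 2]. *)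
exists (2 * K / e + 2) => x xA.
have KE : 0 < 2 * K / e by rewrite divr_gt0 ?mulr_gt0.
rewrite ger0_norm ?(ltW (gauss_gt0 _))// gaussE -/K mulNr expRN.
have h1 := expR_ge1Dx (x ^+ 2 / 2).
have h2 : 2 * K / e <= x ^+ 2 by nra.
rewrite ler_pdivrMr ?expR_gt0// mulrC -ler_pdivrMr//.
by apply: le_trans h1; rewrite -mulrA in h2; lra.
Qed.

Lemma Phi_increment (a x y : R) : 0 <= x -> x <= y -> y <= a ->
  (y - x) * gauss a <= Phi y - Phi x.
Proof.
move=> x0; rewrite le_eqVlt => /predU1P[->|xy ya]; first by rewrite !subrr mul0r.
have [c /andP[xc cy] ->] := is_derive_MVT Phi_derive xy.
rewrite [leRHS]mulrC ler_wpM2l ?subr_ge0 ?(ltW xy)//.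
have c0 : 0 <= c by apply: le_trans (ltW xc).
have ca : c <= a by apply: le_trans ya; exact: ltW.
rewrite !gaussE ler_wpM2l ?normal_peak_ge0// ler_expR ler_wpM2r ?invr_ge0//.
by rewrite lerN2 ler_sqr ?nnegrE// (le_trans c0).
Qed.

Lemma normal_stein z : exists f : R -> R,
  let g := fun x => x * f x in
  [/\ {homo g : x y / x <= y},
      forall x, `|g x| <= 1 &
      forall x y, `|f x - f y - (x - y) * (g x + step z x - Phi z)| <=
        (x - y) * (g x - g y) + (x - y) * (step z y - step z x)].
Proof.
exists (stein_sol Phi gauss z); split.
- exact: (stein_nd gauss_gt0 gauss_ub gaussN Phi_derive gauss_derive
    Phi_pinfty Phi_ninfty).
- exact: (stein_norm_le gauss_gt0 gauss_ub gaussN Phi_derive gauss_derive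
    Phi_pinfty Phi_ninfty gauss_vanishes).
- exact: (stein_increment gauss_gt0 gauss_ub gaussN Phi_derive gauss_derive
    Phi_pinfty Phi_ninfty).
Qed.

Lemma Phi_itv x : 0 <= Phi x <= 1.
Proof.
have := probability_le1 (normal_prob 0 1 : probability _ R)
  (measurable_itv `]-oo, x]).
rewrite /Phi; set m := normal_prob _ _ _ => m1.
have mfin : m \is a fin_num by exact: fin_num_measure.
by rewrite -!lee_fin fineK// m1 measure_ge0.
Qed.

End standard_normal.

(** * Stein's equation for the binomial law *)

Section binomial_stein_equation.
Context (R : realType).

Section solution.
Context (n : nat) (p : R).

(* Up to the factor binom_mass, binom_sol k = binom_sol_rev (n - k) is the
   opposite of the Stein solution for the indicator of {1}, computed downwards
   from k = n; only the ranks k >= 1 are meaningful, and the value 0 at k = n is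
   harmless since it only occurs multiplied by n - k. *)
Fixpoint binom_sol_rev (j : nat) : R :=
  if j is j'.+1 then
    (j'%:R * p * binom_sol_rev j' + 1) / ((n - j')%:R * (1 - p))
  else 0.

Definition binom_sol k := binom_sol_rev (n - k).

Lemma binom_solE k : (k < n)%N ->
  binom_sol k = ((n - k.+1)%:R * p * binom_sol k.+1 + 1) / (k.+1%:R * (1 - p)).
Proof. by move=> kn; rewrite /binom_sol -subSS subSn//= subKn. Qed.

Hypothesis p_gt0 : 0 < p.
Hypothesis p_le : p <= 2^-1.
Hypothesis n_gt0 : (0 < n)%N.

Let p_lt1 : 0 < 1 - p.
Proof. by rewrite subr_gt0 (le_lt_trans p_le)// invf_lt1// ltr1n. Qed.

Lemma binom_sol_ge0 k : (k <= n)%N -> 0 <= binom_sol k.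
Proof.
rewrite /binom_sol => _; elim: (n - k)%N => //= j ih.
by rewrite divr_ge0 ?addr_ge0 ?mulr_ge0 ?(ltW p_lt1) ?(ltW p_gt0).
Qed.

Lemma binom_sol_le (a : R) (K : nat) : n%:R * p *+ 2 <= a -> a *+ 2 <= K%:R ->
  (2 <= K)%N ->
  forall k, (k <= n)%N -> binom_sol k <= (a + 2) ^+ (K - k) *+ 2.
Proof.
move=> npa aK K2 k kn.
have a0 : 0 <= a by apply: le_trans npa; rewrite mulrn_wge0 ?mulr_ge0 ?(ltW p_gt0).
have a2 : 1 <= a + 2 by lra.
rewrite -(subKn kn); move: (n - k)%N (leq_subr k n) => j; elim: j => [|j ih] jn.
  rewrite subn0 /binom_sol subnn /= mulrn_wge0// exprn_ge0//; lra.
have nj : (n - j.+1 < n)%N by rewrite ltn_subrL.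
rewrite binom_solE// -subSn// subSS subnS.
have := ih (ltnW jn); move: (binom_sol_ge0 (leq_subr j n)).
have j_gt0 : (0 < n - j)%N by rewrite subn_gt0.
move: (n - j)%N j_gt0 (leq_subr j n) => i i0 i_n.
set s := binom_sol i => s0 sle.
have -> : (K - i.-1)%N = (K - i + (i <= K))%N.
  by clear -i0; case: leqP; lia.
have ni : (n - i)%:R * p *+ 2 <= a.
  apply: le_trans npa; rewrite lerMn2r/= ler_wpM2r ?(ltW p_gt0)//.
  by rewrite ler_nat leq_subr.
have i_1 : 1 <= i%:R :> R by rewrite ler1n.
have p2 : 1 <= (1 - p) *+ 2 by have := p_le; rewrite mulrnBl; lra.
have step_le : ((n - i)%:R * p * s + 1) / (i%:R * (1 - p)) <= (a * s + 2) / i%:R.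
  rewrite ler_pdivlMr// ?(lt_le_trans ltr01)// invfM mulrA.
  rewrite mulrAC divfK ?gt_eqF ?(lt_le_trans ltr01)// ler_pdivrMr//.
  have nps : (n - i)%:R * p *+ 2 * s <= a * s by rewrite ler_wpM2r.
  have as0 : 0 <= a * s by rewrite mulr_ge0.
  have h : 0 <= ((1 - p) *+ 2 - 1) * (a * s + 2).
    by rewrite mulr_ge0 ?subr_ge0//; lra.
  by move: nps h; rewrite !mulr2n; lra.
have e1 m : 1 <= (a + 2) ^+ m by rewrite exprn_ege1.
apply: (le_trans step_le).
have [iK|Ki] := leqP i K.
  rewrite addn1 exprS; set E := (a + 2) ^+ _ in sle *.
  have E1 : 1 <= E by exact: e1.
  rewrite ler_pdivrMr ?(lt_le_trans ltr01)//.
  apply: (@le_trans _ _ ((a + 2) * E *+ 2 * 1)); last first.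
    by rewrite ler_wpM2l// mulrn_wge0// mulr_ge0; lra.
  have : a * s <= a * (E *+ 2) by rewrite ler_wpM2l.
  by rewrite !mulr2n; lra.
have Ki0 : (K - i = 0)%N by apply/eqP; rewrite subn_eq0 ltnW.
move: sle; rewrite Ki0 addn0 expr0 => sle.
rewrite ler_pdivrMr ?(lt_le_trans ltr01)//.
have as2 : a * s <= a * (1 *+ 2) by rewrite ler_wpM2l.
have KR : K%:R <= i%:R :> R by rewrite ler_nat ltnW.
have K2R : 2 <= K%:R :> R by rewrite ler_nat.
by move: as2 aK; rewrite !mulr2n; lra.
Qed.

(* The mass at 1 of Bin(n, p), in the form forced by solvability at k = 1. *)
Definition binom_mass : R :=
  (1 + n.-1%:R * p * binom_sol 1 + (1 - p) / (n%:R * p))^-1.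

(** The constant 1 solves the equation for the linear part [k], and the other term corrects for the
    indicator of 1. The value at 0 is forced by the equation at [k = 0]. *)
Definition stein_h (k : nat) : R :=
  if k is 0 then 1 - binom_mass / (n%:R * p)
  else 1 + binom_mass * binom_sol k.

Let np_gt0 : 0 < n%:R * p.
Proof. by rewrite mulr_gt0 ?ltr0n. Qed.

Let sol1_ge0 : 0 <= binom_sol 1.
Proof. exact: binom_sol_ge0. Qed.

Let mass_den : 1 <= 1 + n.-1%:R * p * binom_sol 1 + (1 - p) / (n%:R * p).
Proof.
rewrite -addrA lerDl addr_ge0// ?divr_ge0 ?(ltW p_lt1) ?(ltW np_gt0)//.
by rewrite !mulr_ge0 ?(ltW p_gt0).
Qed.

Lemma binom_mass_itv : 0 < binom_mass <= 1.
Proof.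
have d0 := lt_le_trans ltr01 mass_den.
by rewrite /binom_mass invr_gt0 d0 invf_le1.
Qed.

(** The cases 0 and 1 hold by the choice of [stein_h 0] and of [binom_mass]; from 2 on it is the
    recursion for [binom_sol]. *)
Lemma stein_hE k : (k <= n)%N ->
  (n - k)%:R * p * stein_h k - k%:R * (1 - p) * stein_h k.-1 =
  (n%:R * p - binom_mass) - (k%:R - (k == 1%N)%:R).
Proof.
case: k => [|[|k]] kn.
- rewrite subn0 /= mul0r mul0r !subr0 mulrBr mulr1 mulrCA divff ?gt_eqF//.
  by rewrite mulr1.
- rewrite /= subn1 mul1r subrr subr0.
  have np0 := lt0r_neq0 np_gt0.
  have den0 := lt0r_neq0 (lt_le_trans ltr01 mass_den).
  set D := 1 + _ + _ in den0.
  have mD : binom_mass * D = 1 by rewrite /binom_mass mulVf.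
  have n1 : n%:R = n.-1%:R + 1 :> R by rewrite natr1 prednK.
  have -> : n%:R * p - binom_mass = n%:R * p - 1 + (binom_mass * D - binom_mass).
    by rewrite mD; ring.
  rewrite /D n1; rewrite n1 in np0; field.
  by move: np0; rewrite mulf_eq0 negb_or andbC.
- have -> : (k.+2 == 1)%N = false by [].
  rewrite mulr0n subr0 /= (binom_solE kn) natrB//.
  have p0 := lt0r_neq0 p_lt1.
  by field; rewrite p0 -natrD pnatr_eq0.
Qed.

(** The two terms of [stein_h 0] nearly cancel: their difference is [e / (1 + e)] with [e] of order
    [n * p]. Hence an empty urn of small probability weighs little. *)
Lemma stein_h0_le (B : R) : binom_sol 1 <= B -> n%:R * p <= B ->
  `|stein_h 0| <= (1 + B * B) * (n%:R * p).
Proof.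
move=> sB npB; have B0 := le_trans sol1_ge0 sB.
have np0 := lt0r_neq0 np_gt0.
have n1 : n%:R = n.-1%:R + 1 :> R by rewrite natr1 prednK.
pose e := n.-1%:R * p * (1 + n%:R * p * binom_sol 1).
have e0 : 0 <= e by rewrite mulr_ge0 ?addr_ge0 ?mulr_ge0 ?(ltW p_gt0).
have -> : stein_h 0 = e / (1 + e).
  have d0 : 1 + e != 0 by rewrite lt0r_neq0// ltr_pwDl.
  rewrite /= /binom_mass.
  have -> : 1 + n.-1%:R * p * binom_sol 1 + (1 - p) / (n%:R * p) =
      (1 + e) / (n%:R * p).
    rewrite /e n1; rewrite n1 in np0; field.
    by move: np0; rewrite mulf_eq0 negb_or andbC.
  by rewrite invf_div mulrAC mulfV// mul1r; field.
rewrite ger0_norm ?divr_ge0 ?addr_ge0//.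
apply: (@le_trans _ _ e); first by rewrite ler_pdivrMr ?ltr_pwDl// ler_peMr// lerDl.
rewrite /e mulrC ler_pM ?addr_ge0 ?mulr_ge0 ?(ltW p_gt0)//.
  by rewrite lerD2l ler_pM// ltW.
by rewrite ler_wpM2r ?(ltW p_gt0)// ler_nat leq_pred.
Qed.

Lemma stein_h_le (B : R) k : (0 < k)%N -> binom_sol k <= B -> (k <= n)%N ->
  `|stein_h k| <= 1 + B.
Proof.
case: k => // k _ sB kn; have s0 := binom_sol_ge0 kn.
have /andP[m0 m1] := binom_mass_itv.
rewrite /= ger0_norm ?addr_ge0 ?mulr_ge0 ?(ltW m0)// lerD2l.
by rewrite (le_trans _ sB)// ler_piMl.
Qed.

End solution.

Lemma binomial_stein (gam : R) : exists C : R, 0 <= C /\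
  forall n (p : R), (0 < n)%N -> 0 < p -> p <= 2^-1 -> n%:R * p <= gam ->
  exists (h : nat -> R) (c : R),
  [/\ forall k, (k <= n)%N ->
       (n - k)%:R * p * h k - k%:R * (1 - p) * h k.-1 = c - (k%:R - (k == 1%N)%:R),
     `|h 0%N| <= C * (n%:R * p) &
     forall k, (k <= n)%N -> `|h k| <= C].
Proof.
have [gam0|gam0] := ltP gam 0.
  exists 0; split=> // n p n0 p0 _ npg; exfalso; move: gam0.
  by apply/negP; rewrite -leNgt (le_trans _ npg)// mulr_ge0 ?(ltW p0).
pose a := gam *+ 2; pose K := (Num.truncn (a *+ 2)).+2.
have a0 : 0 <= a by rewrite mulrn_wge0.
have aK : a *+ 2 <= K%:R.
  apply/ltW/(lt_trans (truncnS_gt _)); by rewrite ltr_nat.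
pose B := (a + 2) ^+ K *+ 2 + gam.
have E1 m : 1 <= (a + 2) ^+ m by rewrite exprn_ege1//; lra.
have B0 : 0 <= B by have := E1 K; rewrite /B mulr2n; lra.
have BB : 0 <= B * B by rewrite mulr_ge0.
(* Dominates [1 + B], [1 + B * B] and [(1 + B * B) * gam]. *)
exists (1 + (1 + gam) * (B + B * B + 1)).
have gB : 0 <= gam * (B + B * B + 1) by rewrite mulr_ge0//; lra.
split; first by lra.
move=> n p n0 p0 p2 npg; exists (stein_h n p), (n%:R * p - binom_mass n p).
have sB k : (k <= n)%N -> binom_sol n p k <= B.
  move=> kn; have npa : n%:R * p *+ 2 <= a by rewrite lerMn2r.
  apply: (le_trans (binom_sol_le p0 p2 n0 npa aK _ kn)) => //.
  rewrite /B (@le_trans _ _ ((a + 2) ^+ K *+ 2))// ?lerDl//.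
  by rewrite lerMn2r ler_weXn2l ?leq_subr//; lra.
have np0 : 0 <= n%:R * p by rewrite mulr_ge0// ltW.
have npB : n%:R * p <= B by rewrite /B; have := E1 K; rewrite mulr2n; lra.
have h0 := stein_h0_le p0 p2 n0 (sB _ n0) npB.
split; first exact: stein_hE.
  by apply: (le_trans h0); rewrite ler_wpM2r//; lra.
move=> [|k] kn; last first.
  by apply: (le_trans (stein_h_le p0 p2 n0 _ (sB _ kn) kn)) => //; lra.
apply: (le_trans h0); apply: (@le_trans _ _ ((1 + B * B) * gam)).
  by rewrite ler_wpM2l//; lra.
have gB2 : 0 <= gam * B by rewrite mulr_ge0.
by lra.
Qed.

End binomial_stein_equation.

(** * Occupancy counts *)

Section occupancy.
Context (R : realType) (n : nat) (U : finType).
Implicit Types (w : {ffun 'I_n -> U}) (i j : 'I_n) (a b x : U).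

Definition cnt w x : nat := \sum_k (w k == x).
Definition cnto i w x : nat := \sum_(k | k != i) (w k == x).
Definition cntoo i j w x : nat := \sum_(k | (k != i) && (k != j)) (w k == x).

Lemma cntE i w x : cnt w x = (cnto i w x + (w i == x))%N.
Proof. by rewrite /cnt (bigD1 i)//= addnC. Qed.

Lemma cntoE i j w x : i != j ->
  cnto i w x = (cntoo i j w x + (w j == x))%N.
Proof.
by move=> ij; rewrite /cnto (bigD1 j)/= 1?addnC// eq_sym.
Qed.

Lemma cnto_upd i w a x : cnto i (upd w i a) x = cnto i w x.
Proof. by apply: eq_bigr => k ki; rewrite upd_neq. Qed.

Lemma cntoo_upd i j w a x : cntoo i j (upd w j a) x = cntoo i j w x.
Proof. by apply: eq_bigr => k /andP[_ kj]; rewrite upd_neq. Qed.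

Lemma cnto_le_cnt i w x : (cnto i w x <= cnt w x)%N.
Proof. by rewrite (cntE i) leq_addr. Qed.

Lemma cnt_le w x : (cnt w x <= n)%N.
Proof.
rewrite -[leqRHS](card_ord n) -sum1_card; apply: leq_sum => i _.
exact: leq_b1.
Qed.

Lemma sum_pred1 (f : U -> R) a : \sum_x (a == x)%:R * f x = f a.
Proof.
rewrite (bigD1 a)//= eqxx mul1r big1 ?addr0// => x /negbTE xa.
by rewrite eq_sym xa mul0r.
Qed.

Lemma sum_ord_cst (c : R) : \sum_(k < n) c = n%:R * c.
Proof. by rewrite sumr_const card_ord mulr_natl. Qed.

Lemma cntR w x : (cnt w x)%:R = \sum_k (w k == x)%:R :> R.
Proof. by rewrite natr_sum. Qed.

Lemma sum_balls (f : U -> nat -> R) w :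
  \sum_i f (w i) (cnto i w (w i)) = \sum_x (cnt w x)%:R * f x (cnt w x).-1.
Proof.
transitivity (\sum_i \sum_x (w i == x)%:R * f x (cnt w x).-1).
  apply: eq_bigr => i _; rewrite sum_pred1 (cntE i) eqxx addn1.
  by [].
by rewrite exchange_big; apply: eq_bigr => x _; rewrite cntR mulr_suml.
Qed.

Lemma sum_cnto (f : nat -> R) w x :
  \sum_i f (cnto i w x) =
  (cnt w x)%:R * f (cnt w x).-1 + (n - cnt w x)%:R * f (cnt w x).
Proof.
transitivity (\sum_i ((w i == x)%:R * f (cnt w x).-1
    + (1 - (w i == x)%:R) * f (cnt w x))).
  apply: eq_bigr => i _; rewrite (cntE i); case: (w i == x).
    by rewrite addn1 mul1r subrr mul0r addr0.
  by rewrite addn0 mul0r subr0 mul1r add0r.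
rewrite big_split -!mulr_suml /= -cntR; congr (_ + _ * _).
by rewrite sumrB -cntR natrB ?cnt_le// sumr_const card_ord.
Qed.

Definition noniso w : R := \sum_i (0 < cnto i w (w i))%:R.

(* The number of non-isolated balls in an urn holding k balls. *)
Definition excess (k : nat) : R := k%:R - (k == 1%N)%:R.

Lemma nonisoE w : noniso w = \sum_x excess (cnt w x).
Proof.
rewrite /noniso (sum_balls (fun _ k => (0 < k)%:R)).
apply: eq_bigr => x _; rewrite /excess.
by case: (cnt w x) => [|[|k]]; rewrite ?mul0r ?mulr0 ?subrr// mulr1 subr0.
Qed.

(** The increase of the number of non-isolated balls when a ball joins an urn that holds [k]. *)
Definition jump (k : nat) : R := (0 < k)%:R + (k == 1%N)%:R.

Lemma jumpE k : jump k = excess k.+1 - excess k.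
Proof.
rewrite /jump /excess; case: k => [|[|k]] /=.
- by ring.
- by rewrite mulr0n mulr1n; ring.
- by rewrite !mulr0n mulr1n !subr0 addr0 -[k.+3]addn1 natrD addrAC subrr add0r.
Qed.

Lemma noniso_remove i w :
  noniso w = \sum_x excess (cnto i w x) + jump (cnto i w (w i)).
Proof.
rewrite nonisoE -(sum_pred1 (fun x => jump (cnto i w x))) -big_split /=.
apply: eq_bigr => x _; rewrite (cntE i) jumpE; case: (w i == x).
  by rewrite addn1 mul1r addrC subrK.
by rewrite addn0 mul0r addr0.
Qed.

Lemma noniso_upd i w b : noniso w - noniso (upd w i b) =
  jump (cnto i w (w i)) - jump (cnto i w b).
Proof.
rewrite !(noniso_remove i) upd_same cnto_upd.
under [X in _ - (X + _)]eq_bigr do rewrite cnto_upd.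
by rewrite opprD addrACA subrr add0r.
Qed.

Lemma jump_ge0 k : 0 <= jump k.
Proof. by rewrite addr_ge0. Qed.

Lemma jump_le k : jump k <= 2 * (0 < k)%:R.
Proof. by rewrite /jump mulrDl mul1r lerD2l ler_nat; case: k => [|[]]. Qed.

Context (p : U -> R).
Hypothesis p_gt0 : forall a, 0 < p a.
Hypothesis p_sum1 : \sum_a p a = 1.

Let p_ge0 a : 0 <= p a. Proof. exact: ltW. Qed.

Notation Ex := (@Ex R n U p).
Notation Var := (@Var R n U p).

(** Grouped by urn, an urn [x] with [k] balls contributes [k * (1 - p x) * h x k.-1 - (n - k) * p x
    * h x k]: the drift of a birth-and-death chain, which [hE] evaluates. *)
Lemma poisson_equation (h : U -> nat -> R) (c : U -> R) w :
  (forall x k, (k <= n)%N ->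
    (n - k)%:R * p x * h x k - k%:R * (1 - p x) * h x k.-1 = c x - excess k) ->
  \sum_i \sum_b p b * (h (w i) (cnto i w (w i)) - h b (cnto i w b)) =
  noniso w - \sum_x c x.
Proof.
move=> hE.
transitivity (\sum_i h (w i) (cnto i w (w i)) -
    \sum_b p b * \sum_i h b (cnto i w b)).
  have -> : \sum_b p b * \sum_i h b (cnto i w b) =
      \sum_i \sum_b p b * h b (cnto i w b).
    by rewrite exchange_big; apply: eq_bigr => b _; rewrite mulr_sumr.
  rewrite -sumrB; apply: eq_bigr => i _.
  under eq_bigr do rewrite mulrBr.
  by rewrite sumrB -mulr_suml p_sum1 mul1r.
rewrite sum_balls nonisoE -!sumrB; apply: eq_bigr => x _.
rewrite sum_cnto; have := hE x (cnt w x) (cnt_le w x).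
move/(congr1 -%R); rewrite !opprB => <-; ring.
Qed.

Lemma Ex1 (k : 'I_n) (f : U -> R) : Ex (fun w => f (w k)) = \sum_a p a * f a.
Proof.
rewrite -(Ex_avg p_sum1 k) -[RHS](@Ex_cst _ n _ _ p_sum1).
by apply: eq_Ex => w; apply: eq_bigr => a _; rewrite upd_same.
Qed.

Lemma Ex_hit (k : 'I_n) a : Ex (fun w => (w k == a)%:R) = p a.
Proof.
rewrite (Ex1 k (fun x => (x == a)%:R)).
under eq_bigr do rewrite eq_sym mulrC.
exact: (sum_pred1 p).
Qed.

Lemma Ex_hit2 (k l : 'I_n) a : k != l ->
  Ex (fun w => (w k == a)%:R * (w l == a)%:R) = p a ^+ 2.
Proof.
move=> kl; rewrite -(Ex_avg p_sum1 k) expr2 -[X in _ = _ * X](Ex_hit l) -ExZ.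
apply: eq_Ex => w; rewrite /avg.
under eq_bigr do rewrite upd_same upd_neq 1?eq_sym// eq_sym mulrCA -/(_ * _).
rewrite -(sum_pred1 (fun x => p x * (w l == a)%:R)).
by apply: eq_bigr => x _; rewrite eq_sym.
Qed.

Let lam a : R := n%:R * p a.

Let lam_ge0 a : 0 <= lam a. Proof. by rewrite mulr_ge0. Qed.

Lemma Ex_cnt a : Ex (fun w => (cnt w a)%:R) = lam a.
Proof.
rewrite (eq_Ex p (fun w => cntR w a)) Ex_sum.
under eq_bigr do rewrite Ex_hit.
by rewrite sum_ord_cst.
Qed.

Lemma Ex_cnt2 a : Ex (fun w => (cnt w a)%:R ^+ 2) <= lam a + lam a ^+ 2.
Proof.
have E w : (cnt w a)%:R ^+ 2 =
    \sum_k \sum_l (w k == a)%:R * (w l == a)%:R :> R.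
  rewrite expr2 {1}cntR mulr_suml; apply: eq_bigr => k _.
  by rewrite cntR mulr_sumr.
rewrite (eq_Ex p E) Ex_sum.
apply: (@le_trans _ _ (\sum_(k < n) (p a + n%:R * p a ^+ 2))); last first.
  rewrite sum_ord_cst mulrDr lerD2l.
  by rewrite /lam exprMn mulrA -expr2.
apply: ler_sum => k _; rewrite Ex_sum (bigD1 k)//= lerD//.
  rewrite (_ : Ex _ = p a)// -(Ex_hit k); apply: eq_Ex => w.
  by case: (_ == _); rewrite ?mulr1 ?mulr0.
apply: (@le_trans _ _ (\sum_(l < n) p a ^+ 2)); last first.
  by rewrite sum_ord_cst.
rewrite [leRHS](bigD1 k)//= -[leLHS]add0r lerD ?sqr_ge0//.
by apply: ler_sum => l lk; rewrite Ex_hit2// eq_sym.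
Qed.

Context (gam : R).
Hypothesis lam_le : forall a, lam a <= gam.

Let tau : R := \sum_a p a * lam a.

Let tau_ge0 : 0 <= tau.
Proof. by apply: sumr_ge0 => a _; rewrite mulr_ge0. Qed.

Definition intensity : R := n%:R ^+ 2 * \sum_a p a ^+ 2.

Let n_tau : n%:R * tau = intensity.
Proof.
rewrite /tau /intensity /lam !mulr_sumr; apply: eq_bigr => a _.
by rewrite mulrCA mulrA; ring.
Qed.

Let U_inh : exists a : U, true.
Proof.
case: (pickP (@predT U)) => [a _|U0]; first by exists a.
by exfalso; move: p_sum1; rewrite big_pred0// => /eqP; rewrite eq_sym oner_eq0.
Qed.

Let gam_ge0 : 0 <= gam.
Proof. by have [a _] := U_inh; apply: le_trans (lam_le a). Qed.

Let tau_le : tau <= gam.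
Proof.
rewrite -[leRHS]mul1r -p_sum1 mulr_suml; apply: ler_sum => a _.
by rewrite ler_wpM2l.
Qed.

(** After averaging over ball [j], its urn is independent of the other balls, and the second moment
    of the count in urn [a] is at most [(1 + gam) * lam a]. *)
Lemma Ex_others2 j : Ex (fun w => (cnto j w (w j))%:R ^+ 2) <= (1 + gam) * tau.
Proof.
rewrite -(Ex_avg p_sum1 j).
apply: (@le_trans _ _ (Ex (fun w => \sum_a p a * (cnt w a)%:R ^+ 2))).
  apply: ler_Ex => // w; apply: ler_sum => a _.
  rewrite ler_wpM2l// upd_same cnto_upd.
  by rewrite ler_sqr ?nnegrE// ler_nat cnto_le_cnt.
rewrite Ex_sum mulr_sumr; apply: ler_sum => a _; rewrite ExZ mulrCA.
rewrite ler_wpM2l//; apply: le_trans (Ex_cnt2 a) _.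
by rewrite mulrDl mul1r lerD2l expr2 ler_wpM2r.
Qed.

(** Efron-Stein with ball [j] deleted: the deletion changes the count by a [jump], which is at most
    twice the number of companions of [j]. *)
Lemma Var_noniso_le : Var noniso <= 4 * (1 + gam) * intensity.
Proof.
have inv j w a : \sum_x excess (cnto j (upd w j a) x) =
    \sum_x excess (cnto j w x) by under eq_bigr do rewrite cnto_upd.
apply: le_trans (efron_stein p_ge0 p_sum1 noniso inv) _.
rewrite -n_tau mulrCA -sum_ord_cst.
apply: ler_sum => j _; rewrite -mulrA.
apply: (@le_trans _ _ (4 * Ex (fun w => (cnto j w (w j))%:R ^+ 2))); last first.
  by rewrite ler_wpM2l// Ex_others2.
rewrite -ExZ; apply: ler_Ex => // w.
rewrite (noniso_remove j) addrAC subrr add0r.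
rewrite (_ : 4 * _ = (2 * (cnto j w (w j))%:R) ^+ 2); last by ring.
rewrite ler_sqr ?nnegrE ?jump_ge0 ?mulr_ge0//.
apply: le_trans (jump_le _) _; rewrite ler_wpM2l// ler_nat.
by case: (cnto _ _ _).
Qed.

(** The sum over the balls of the conditional expectation, given [w], of [Q] at the redraw of that
    ball. *)
Definition pair_sum (Q : U -> nat -> U -> nat -> R) w : R :=
  \sum_i \sum_b p b * Q (w i) (cnto i w (w i)) b (cnto i w b).

Let pair_sum_rm Q j w : R :=
  \sum_(i | i != j) \sum_b
    p b * Q (w i) (cntoo i j w (w i)) b (cntoo i j w b).

Let dev j w : R := lam (w j) + (cnto j w (w j))%:R + tau
  + \sum_b p b * (cnto j w b)%:R.

Lemma natr_gt0_le (k : nat) : (0 < k)%:R <= k%:R :> R.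
Proof. by rewrite ler_nat; case: k. Qed.

(** Deleting ball [j] drops the term [i = j], bounded through the hypothesis [Qs], and alters
    another term only if the old or the new urn of [i] is that of [j], by at most [2 * K]. *)
Lemma pair_sum_dev Q K j w : 0 <= K ->
  (forall a k b l, `|Q a k b l| <= K) ->
  (forall a k b l,
    `|Q a k b l| <= K * (lam a + lam b + (0 < k)%:R + (0 < l)%:R)) ->
  `|pair_sum Q w - pair_sum_rm Q j w| <= 3 * K * dev j w.
Proof.
move=> K0 QK Qs.
have h1 : `|\sum_b p b * Q (w j) (cnto j w (w j)) b (cnto j w b)| <=
    K * dev j w.
  apply: le_trans (ler_norm_sum _ _ _) _.
  rewrite (_ : K * dev j w = \sum_b p b * (K * (lam (w j) + lam b
      + (cnto j w (w j))%:R + (cnto j w b)%:R))).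
    apply: ler_sum => b _; rewrite normrM ger0_norm// ler_wpM2l//.
    apply: le_trans (Qs _ _ _ _) _; rewrite ler_wpM2l//.
    by rewrite lerD ?natr_gt0_le// lerD2l natr_gt0_le.
  rewrite (eq_bigr (fun b => K * (p b * (lam (w j) + (cnto j w (w j))%:R)
      + p b * lam b + p b * (cnto j w b)%:R))); last by move=> b _; ring.
  by rewrite -mulr_sumr !big_split/= -mulr_suml p_sum1 mul1r.
have h2 i : i != j ->
    `|\sum_b p b * Q (w i) (cnto i w (w i)) b (cnto i w b) -
      \sum_b p b * Q (w i) (cntoo i j w (w i)) b (cntoo i j w b)| <=
    2 * K * ((w i == w j)%:R + p (w j)).
  move=> ij; rewrite -sumrB; apply: le_trans (ler_norm_sum _ _ _) _.
  rewrite (_ : _ * _ = \sum_b p b * (2 * K * ((w i == w j)%:R + (w j == b)%:R))).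
    apply: ler_sum => b _; rewrite -mulrBr normrM ger0_norm// ler_wpM2l//.
    rewrite !(cntoE w _ ij) (eq_sym (w i)).
    case: (w j == w i) => /=; last case: (w j == b) => /=.
    - apply: le_trans (ler_normB _ _) _.
      apply: (@le_trans _ _ (2 * K)); first by rewrite mulr2n mulrDl mul1r lerD.
      by rewrite ler_peMr ?mulr_ge0// lerDl.
    - apply: le_trans (ler_normB _ _) _.
      by rewrite add0r mulr1 mulr2n mulrDl mul1r lerD.
    - by rewrite !addn0 subrr normr0 addr0 mulr0.
  rewrite (eq_bigr (fun b => 2 * K * (p b * (w i == w j)%:R
      + (w j == b)%:R * p b))); last by move=> b _; ring.
  by rewrite -mulr_sumr big_split/= -mulr_suml p_sum1 mul1r sum_pred1.
have h3 : \sum_(i | i != j) 2 * K * ((w i == w j)%:R + p (w j)) <=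
    2 * K * dev j w.
  rewrite -mulr_sumr ler_wpM2l ?mulr_ge0// big_split/=.
  have s1 : \sum_(i | i != j) (w i == w j)%:R = (cnto j w (w j))%:R :> R.
    by rewrite natr_sum.
  have s2 : \sum_(i | i != j) p (w j) <= lam (w j).
    rewrite (@le_trans _ _ (\sum_(i < n) p (w j)))//.
      by rewrite [leRHS](bigD1 j)//= lerDr.
    by rewrite sum_ord_cst.
  have s3 : 0 <= \sum_b p b * (cnto j w b)%:R.
    by apply: sumr_ge0 => b _; rewrite mulr_ge0.
  by rewrite s1 /dev; have := tau_ge0; lra.
rewrite /pair_sum (bigD1 j)//= -addrA -sumrB.
apply: le_trans (ler_normD _ _) _.
rewrite (_ : 3 * K * _ = K * dev j w + 2 * K * dev j w); last by ring.
apply: lerD => //; apply: le_trans h3.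
by apply: le_trans (ler_norm_sum _ _ _) _; apply: ler_sum => i ij; exact: h2.
Qed.

Lemma Ex_dev2 j : Ex (fun w => dev j w ^+ 2) <= 16 * (1 + gam) * tau.
Proof.
have T1 : 0 <= (1 + gam) * tau by rewrite mulr_ge0// addr_ge0.
have gT : gam * tau <= (1 + gam) * tau by rewrite ler_wpM2r// lerDr.
pose A w := lam (w j); pose B w : R := (cnto j w (w j))%:R.
pose D w := \sum_b p b * (cnto j w b)%:R.
have EA : Ex (fun w => A w ^+ 2) <= (1 + gam) * tau.
  apply: le_trans gT.
  apply: (@le_trans _ _ (Ex (fun w => gam * A w))).
    apply: ler_Ex => // w; rewrite expr2.
    by apply: ler_wpM2r; [exact: lam_ge0|exact: lam_le].
  by rewrite ExZ (Ex1 j lam).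
have EB : Ex (fun w => B w ^+ 2) <= (1 + gam) * tau by exact: Ex_others2.
have EC : Ex (fun=> tau ^+ 2) <= (1 + gam) * tau.
  by rewrite Ex_cst//; apply: le_trans gT; rewrite expr2 ler_wpM2r.
have ED : Ex (fun w => D w ^+ 2) <= (1 + gam) * tau.
  pose D' w := \sum_b p b * (cnt w b)%:R.
  have D0 w : 0 <= D w by apply: sumr_ge0 => b _; rewrite mulr_ge0.
  have DD' w : D w <= D' w.
    by apply: ler_sum => b _; rewrite ler_wpM2l// ler_nat cnto_le_cnt.
  (* [D' w] is the sum of [p (w k)] over the balls, hence at most [n] times the largest
     probability. *)
  have D'g w : D' w <= gam.
    rewrite (_ : D' w = \sum_k p (w k)).
      have n0 : 0 < n%:R :> R by rewrite ltr0n (leq_trans _ (ltn_ord j)).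
      rewrite -(ler_pM2l n0) mulr_sumr -sum_ord_cst.
      by apply: ler_sum => k _; exact: lam_le.
    rewrite /D'; under eq_bigr do rewrite cntR mulr_sumr.
    rewrite exchange_big; apply: eq_bigr => k _ /=.
    by under eq_bigr do rewrite mulrC; rewrite sum_pred1.
  apply: le_trans gT.
  apply: (@le_trans _ _ (Ex (fun w => gam * D' w))).
    apply: ler_Ex => // w; rewrite expr2 ler_pM//.
    exact: le_trans (DD' w) (D'g w).
  rewrite ExZ Ex_sum ler_wpM2l//; apply: ler_sum => b _.
  by rewrite ExZ Ex_cnt.
apply: (@le_trans _ _ (4 * (Ex (fun w => A w ^+ 2) + Ex (fun w => B w ^+ 2)
   + Ex (fun=> tau ^+ 2) + Ex (fun w => D w ^+ 2)))); last by lra.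
rewrite -!ExD -ExZ; apply: ler_Ex => // w; rewrite /dev -/(A w) -/(B w) -/(D w).
have := sqr_ge0 (A w - B w); have := sqr_ge0 (A w - tau).
have := sqr_ge0 (A w - D w); have := sqr_ge0 (B w - tau).
have := sqr_ge0 (B w - D w); have := sqr_ge0 (tau - D w).
nra.
Qed.

(** Efron-Stein with ball [j] deleted; 144 is the product of [3 ^+ 2] from [pair_sum_dev] and 16
    from [Ex_dev2]. *)
Lemma Var_pair_sum Q K : 0 <= K ->
  (forall a k b l, `|Q a k b l| <= K) ->
  (forall a k b l,
    `|Q a k b l| <= K * (lam a + lam b + (0 < k)%:R + (0 < l)%:R)) ->
  Var (pair_sum Q) <= 144 * K ^+ 2 * (1 + gam) * intensity.
Proof.
move=> K0 QK Qs.
have inv j w a : pair_sum_rm Q j (upd w j a) = pair_sum_rm Q j w.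
  apply: eq_bigr => i ij; apply: eq_bigr => b _.
  by rewrite upd_neq// !cntoo_upd.
apply: le_trans (efron_stein p_ge0 p_sum1 (pair_sum Q) inv) _.
rewrite -n_tau mulrCA -sum_ord_cst.
apply: ler_sum => j _.
apply: (@le_trans _ _ ((3 * K) ^+ 2 * Ex (fun w => dev j w ^+ 2))).
  rewrite -ExZ; apply: ler_Ex => // w; rewrite -exprMn.
  have := pair_sum_dev j w K0 QK Qs => h.
  by rewrite -real_normK ?num_real// ler_sqr ?nnegrE// (le_trans _ h).
apply: (@le_trans _ _ ((3 * K) ^+ 2 * (16 * (1 + gam) * tau))).
  by rewrite ler_wpM2l ?sqr_ge0// Ex_dev2.
by rewrite le_eqVlt; apply/orP; left; apply/eqP; ring.
Qed.

End occupancy.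

Lemma urn_stein_solutions (R : realType) (gam : R) : exists C : R, 0 <= C /\
  forall n (U : finType) (p : U -> R), (0 < n)%N ->
  (forall a, 0 < p a) -> (forall a, p a <= 2^-1) ->
  (forall a, n%:R * p a <= gam) ->
  exists (h : U -> nat -> R) (c : U -> R),
  (forall x k, (k <= n)%N ->
     (n - k)%:R * p x * h x k - k%:R * (1 - p x) * h x k.-1 = c x - excess R k)
  /\ (forall x k, `|h x k| <= C * (n%:R * p x + (0 < k)%:R)).
Proof.
have [C [C0 hC]] := binomial_stein gam; exists C; split=> // n U p n0 p0 p2 pg.
have /choice[hc hcP] : forall x, exists hc : (nat -> R) * R,
   [/\ forall k, (k <= n)%N ->
       (n - k)%:R * p x * hc.1 k - k%:R * (1 - p x) * hc.1 k.-1 =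
       hc.2 - excess R k,
     `|hc.1 0%N| <= C * (n%:R * p x) &
     forall k, (k <= n)%N -> `|hc.1 k| <= C].
  by move=> x; have [h [c hcP]] := hC _ _ n0 (p0 x) (p2 x) (pg x); exists (h, c).
(* Extending by 0 beyond [n] makes the bound hold for every [k], while the equation only looks at
   ranks up to [n]. *)
exists (fun x k => if (k <= n)%N then (hc x).1 k else 0), (fun x => (hc x).2).
split.
- move=> x k kn; have [hE _ _] := hcP x.
  by rewrite kn (leq_trans (leq_pred _) kn) hE.
- move=> x k; have [_ h0 h1] := hcP x.
  case: (leqP k n) => [kn|_]; last first.
    by rewrite normr0 mulr_ge0// addr_ge0// mulr_ge0// ltW.
  case: k kn => [_|k kn]; first by rewrite addr0.
  apply: le_trans (h1 _ kn) _; rewrite ler_peMr// lerDr mulr_ge0//.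
  exact: ltW.
Qed.

(** * The exchangeable pair *)

Section stein_pair.
Context (R : realType) (n : nat) (U : finType) (p : U -> R).
Hypothesis p_gt0 : forall a, 0 < p a.
Hypothesis p_sum1 : \sum_a p a = 1.

Let p_ge0 a : 0 <= p a. Proof. exact: ltW. Qed.

Notation Omega := {ffun 'I_n -> U}.
Notation Ex := (@Ex R n U p).
Notation Var := (@Var R n U p).
Notation Y := (@noniso R n U).
Notation mu := (Ex Y).

(** As [pair_sum], with an extra factor [T] that depends on both configurations of the exchangeable
    pair. *)
Let bsum (Q : U -> nat -> U -> nat -> R) (T : Omega -> Omega -> R) (w : Omega) :=
  \sum_i \sum_b
    p b * (Q (w i) (cnto i w (w i)) b (cnto i w b) * T w (upd w i b)).

Let antisym (Q : U -> nat -> U -> nat -> R) :=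
  forall a k b l, Q b l a k = - Q a k b l.

(** Swapping the two configurations changes the sign of [Q], so the [G (Y w')] half is the opposite
    of the [G (Y w)] half. *)
Lemma Ex_antisym_swap Q (G : R -> R) : antisym Q ->
  Ex (bsum Q (fun w w' => G (Y w) - G (Y w'))) =
  2 * Ex (fun w => pair_sum p Q w * G (Y w)).
Proof.
move=> Qa.
have E1 : Ex (bsum Q (fun w w' => G (Y w))) =
    Ex (fun w => pair_sum p Q w * G (Y w)).
  apply: eq_Ex => w; rewrite /pair_sum mulr_suml; apply: eq_bigr => i _.
  by rewrite mulr_suml; apply: eq_bigr => b _; rewrite mulrA.
have E2 : Ex (bsum Q (fun w w' => G (Y w'))) =
    - Ex (fun w => pair_sum p Q w * G (Y w)).
  rewrite -E1 !Ex_sum -sumrN; apply: eq_bigr => i _; rewrite -ExN.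
  pose K (w w' : Omega) :=
    Q (w i) (cnto i w (w i)) (w' i) (cnto i w (w' i)) * G (Y w').
  transitivity (Ex (fun w => \sum_b p b * K w (upd w i b))).
    by apply: eq_Ex => w; apply: eq_bigr => b _; rewrite /K upd_same.
  rewrite Ex_exchange//; apply: eq_Ex => w; rewrite -sumrN.
  apply: eq_bigr => b _.
  by rewrite /K upd_same !cnto_upd Qa mulNr mulrN.
have -> : Ex (bsum Q (fun w w' => G (Y w) - G (Y w'))) =
    Ex (bsum Q (fun w w' => G (Y w))) - Ex (bsum Q (fun w w' => G (Y w'))).
  rewrite -ExB; apply: eq_Ex => w; rewrite /bsum -sumrB; apply: eq_bigr => i _.
  by rewrite -sumrB; apply: eq_bigr => b _; ring.
by rewrite E1 E2; ring.
Qed.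

Context (gam C : R) (h : U -> nat -> R) (c : U -> R).
Hypothesis lam_le : forall a, n%:R * p a <= gam.
Hypothesis C_ge0 : 0 <= C.
Hypothesis h_eq : forall x k, (k <= n)%N ->
  (n - k)%:R * p x * h x k - k%:R * (1 - p x) * h x k.-1 = c x - excess R k.
Hypothesis h_le1 : forall x k, `|h x k| <= C * (n%:R * p x + (0 < k)%:R).

(** [F], [J] and [Fs] are the functions F, Delta and F* of the exchangeable pair, in terms of the
    two urns and of their counts without the redrawn ball. *)
Let F a k b l := h a k - h b l.
Let J (a : U) k (b : U) l := jump R k - jump R l.
Let u a (k : nat) := C * (n%:R * p a + (0 < k)%:R).
Let Fs a k b l := u a k + u b l.
Let Q1 a k b l := F a k b l * J a k b l.
Let Q2 a k b l := Fs a k b l * J a k b l.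

Let F_antisym : antisym F.
Proof. by move=> a k b l; rewrite opprB. Qed.

Let Q2_antisym : antisym Q2.
Proof. by move=> a k b l; rewrite /Q2 /Fs /J addrC -mulrN opprB. Qed.

Let F_le a k b l : `|F a k b l| <= Fs a k b l.
Proof. by apply: le_trans (ler_normB _ _) _; rewrite lerD ?h_le1. Qed.

Let J_le a k b l : `|J a k b l| <= 2.
Proof.
have := jump_ge0 R k; have := jump_ge0 R l.
have := jump_le R k; have := jump_le R l.
have b1 (t : nat) : (0 < t)%:R <= 1 :> R by rewrite lern1 leq_b1.
have := b1 k; have := b1 l; rewrite ler_norml /J; lra.
Qed.

Let gam_ge0 : (exists a : U, true) -> 0 <= gam.
Proof.
by move=> [a _]; apply: le_trans (lam_le a); rewrite mulr_ge0.
Qed.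

Let Fs_ge0 a k b l : 0 <= Fs a k b l.
Proof. by rewrite addr_ge0// mulr_ge0// addr_ge0// mulr_ge0. Qed.

Let K := 4 * C * (1 + gam).

Let K_ge0 : 0 <= 1 + gam -> 0 <= K.
Proof. by move=> g0; rewrite !mulr_ge0. Qed.

Let FsE a k b l :
  Fs a k b l = C * (n%:R * p a + n%:R * p b + (0 < k)%:R + (0 < l)%:R).
Proof. by rewrite /Fs /u; ring. Qed.

Let Q_le (Q : U -> nat -> U -> nat -> R) :
  (forall a k b l, `|Q a k b l| <= Fs a k b l * 2) ->
  (forall a k b l, `|Q a k b l| <= K) /\
  (forall a k b l, `|Q a k b l| <= K *
     (n%:R * p a + n%:R * p b + (0 < k)%:R + (0 < l)%:R)).
Proof.
move=> QF; have b1 (t : nat) : (0 < t)%:R <= 1 :> R by rewrite lern1 leq_b1.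
split=> a k b l; have g0 : 0 <= gam by apply: gam_ge0; exists a.
all: apply: le_trans (QF _ _ _ _) _; rewrite FsE.
  rewrite /K (_ : 4 * C * _ = C * ((1 + gam) * 2) * 2); last by ring.
  rewrite ler_wpM2r// ler_wpM2l//.
  have := b1 k; have := b1 l; have := lam_le a; have := lam_le b; lra.
set x := _ + _ + _ + _.
have x0 : 0 <= x by rewrite !addr_ge0// mulr_ge0.
have Cx : 0 <= C * x by rewrite mulr_ge0.
have gCx : 0 <= gam * (C * x) by rewrite mulr_ge0.
by rewrite /K; lra.
Qed.

Let Q1_le a k b l : `|Q1 a k b l| <= Fs a k b l * 2.
Proof. by rewrite normrM ler_pM. Qed.

Let Q2_le a k b l : `|Q2 a k b l| <= Fs a k b l * 2.
Proof. by rewrite normrM ler_pM// ger0_norm. Qed.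

(** The Poisson equation centers [Y] at the sum of the [c x]; antisymmetry with the constant test
    function 1 shows that this sum is the mean. *)
Let Y_centered w : Y w - mu = pair_sum p F w.
Proof.
have E w' := poisson_equation p_sum1 w' h_eq.
have mean0 : Ex (pair_sum p F) = 0.
  have := Ex_antisym_swap (fun=> 1) F_antisym.
  have -> : Ex (bsum F (fun _ _ => 1 - 1)) = 0.
    rewrite -[RHS](@Ex_cst _ n _ _ p_sum1); apply: eq_Ex => w'.
    by rewrite /bsum big1// => i _; rewrite big1// => b _; rewrite subrr !mulr0.
  move/eqP; rewrite eq_sym mulf_eq0 pnatr_eq0/= => /eqP <-.
  by apply: eq_Ex => w'; rewrite mulr1.
have -> : mu = \sum_x c x.
  apply/eqP; rewrite -subr_eq0; apply/eqP; rewrite -[RHS]mean0.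
  rewrite -[X in _ - X](@Ex_cst _ n _ _ p_sum1) -ExB.
  by apply: eq_Ex => w'; rewrite -E.
by rewrite -E.
Qed.

Lemma stein_identity (f : R -> R) :
  2 * Ex (fun w => (Y w - mu) * f (Y w)) =
  Ex (bsum F (fun w w' => f (Y w) - f (Y w'))).
Proof.
rewrite Ex_antisym_swap//; congr (_ * _).
by apply: eq_Ex => w; rewrite Y_centered.
Qed.

Let J_noniso i (w : Omega) b :
  J (w i) (cnto i w (w i)) b (cnto i w b) = Y w - Y (upd w i b).
Proof. by rewrite noniso_upd. Qed.

(** The Stein identity for the identity function. *)
Let Ex_Q1 : Ex (pair_sum p Q1) = 2 * Var Y.
Proof.
transitivity (Ex (bsum F (fun w w' => Y w - Y w'))).
  by apply: eq_Ex => w; apply: eq_bigr => i _; apply: eq_bigr => b _;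
     rewrite -J_noniso.
rewrite -(stein_identity id); congr (_ * _).
rewrite VarE// /= -(@eq_Ex _ _ _ _ (fun w => Y w * Y w - mu * Y w)).
  by rewrite ExB ExZ expr2; congr (_ - _); apply: eq_Ex => w; rewrite expr2.
by move=> w; ring.
Qed.

Let Ex_Q2 : Ex (pair_sum p Q2) = 0.
Proof.
have := Ex_antisym_swap (fun=> 1) Q2_antisym.
have -> : Ex (bsum Q2 (fun _ _ => 1 - 1)) = 0.
  rewrite -[RHS](@Ex_cst _ n _ _ p_sum1); apply: eq_Ex => w'.
  by rewrite /bsum big1// => i _; rewrite big1// => b _; rewrite subrr !mulr0.
move/eqP; rewrite eq_sym mulf_eq0 pnatr_eq0/= => /eqP <-.
by apply: eq_Ex => w'; rewrite mulr1.
Qed.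

Let Ex_mul_le (V G : Omega -> R) (M : R) :
  (forall w, `|G w| <= M) -> Ex V = 0 ->
  `|Ex (fun w => V w * G w)| <= M * Num.sqrt (Var V).
Proof.
move=> GM V0; apply: le_trans (norm_Ex_le p_ge0 _) _.
have M0 : 0 <= M.
  have [w _] : exists w : Omega, true.
    case: (pickP (@predT Omega)) => [w _|O0]; first by exists w.
    exfalso; have := @Ex_cst _ n _ _ p_sum1 1.
    by rewrite /Ex big_pred0// => /eqP; rewrite eq_sym oner_eq0.
  exact: le_trans (GM w).
apply: (@le_trans _ _ (M * Ex (fun w => `|V w|))).
  rewrite -ExZ; apply: ler_Ex => // w; rewrite normrM mulrC.
  exact: ler_wpM2r.
rewrite ler_wpM2l//; apply: le_trans (Ex_norm_le p_ge0 p_sum1 _) _.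
by rewrite VarE// V0 expr0n/= subr0.
Qed.

Lemma kolmogorov_pair_sum z : 0 < Var Y ->
  `|Ex (fun w => step z ((Y w - mu) / Num.sqrt (Var Y))) - Phi z| <=
  (Num.sqrt (Var (pair_sum p Q1)) + 2 * Num.sqrt (Var (pair_sum p Q2))) / Var Y.
Proof.
move=> V0; set sig := Num.sqrt (Var Y); set V := Var Y in V0 sig *.
have sig0 : 0 < sig by rewrite sqrtr_gt0.
have sigV : sig ^+ 2 = V by rewrite sqr_sqrtr// ltW.
have [f [g_nd g_le f_incr]] := normal_stein z.
pose W w := (Y w - mu) / sig; pose tw (y : R) := (y - mu) / sig.
(* [D] is the derivative of [f] as prescribed by the Stein equation; [G] is nondecreasing, and its
   increments control the Taylor remainder [err]. *)
pose D x := x * f x + step z x - Phi z; pose G x := x * f x - step z x.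
have stepb x := step_itv z x; have Phib := Phi_itv z.
have D_le x : `|D x| <= 2.
  have := g_le x; rewrite !ler_norml /D.
  by have /andP[] := stepb x; have /andP[] := Phib; lra.
have G_le x : `|G x| <= 2.
  have := g_le x; rewrite !ler_norml /G.
  by have /andP[] := stepb x; lra.
pose err w w' := f (W w) - f (W w') - (W w - W w') * D (W w).
have err_le w w' : `|err w w'| <= (W w - W w') * (G (W w) - G (W w')).
  by apply: le_trans (f_incr _ _) _; rewrite le_eqVlt; apply/orP; left; apply/eqP;
     rewrite /G; ring.
have WW' w w' : W w - W w' = (Y w - Y w') / sig.
  by rewrite /W -mulrBl; congr (_ / _); ring.
(* The Stein identity for [f \o tw], the increment of [f] being split into its first-order part,
   which produces [Q1], and [err]. *)
have EWf : 2 * V * Ex (fun w => W w * f (W w)) =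
    Ex (fun w => pair_sum p Q1 w * D (W w)) + sig * Ex (bsum F err).
  have -> : 2 * V * Ex (fun w => W w * f (W w)) =
      sig * (2 * Ex (fun w => (Y w - mu) * f (tw (Y w)))).
    rewrite -sigV -!ExZ; apply: eq_Ex => w; rewrite -/(W w) /W; field.
    exact: lt0r_neq0.
  rewrite (stein_identity (f \o tw)) -!ExZ -ExD; apply: eq_Ex => w.
  rewrite /bsum /pair_sum !mulr_sumr mulr_suml -big_split; apply: eq_bigr => i _.
  rewrite !mulr_sumr mulr_suml -big_split; apply: eq_bigr => b _ /=.
  rewrite /err /= -!/(W _) WW' /Q1 J_noniso; field.
  exact: lt0r_neq0.
(* F* is symmetric and Delta antisymmetric, so the expectation of
   F* Delta (G(W) - G(W')) is twice that of (sum E[F* Delta | w]) G(W). *)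
have err_bound : `|sig * Ex (bsum F err)| <=
    2 * (2 * Num.sqrt (Var (pair_sum p Q2))).
  rewrite normrM (gtr0_norm sig0).
  apply: (@le_trans _ _ (2 * Ex (fun w => pair_sum p Q2 w * G (W w)))); last first.
    rewrite ler_wpM2l//; apply: le_trans (ler_norm _) _.
    exact: (Ex_mul_le (G := fun w => G (W w)) (fun w => G_le (W w)) Ex_Q2).
  rewrite -(Ex_antisym_swap (G \o tw) Q2_antisym).
  apply: (@le_trans _ _ (sig * Ex (fun w => `|bsum F err w|))).
    by rewrite ler_wpM2l ?(ltW sig0)// norm_Ex_le.
  rewrite -ExZ; apply: ler_Ex => // w; rewrite -ler_pdivlMl//.
  apply: le_trans (ler_norm_sum _ _ _) _; rewrite /bsum mulr_sumr.
  apply: ler_sum => i _; apply: le_trans (ler_norm_sum _ _ _) _.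
  rewrite mulr_sumr; apply: ler_sum => b _.
  rewrite normrM ger0_norm// [leRHS]mulrCA ler_wpM2l//.
  rewrite /Q2 J_noniso normrM.
  apply: (@le_trans _ _ (Fs (w i) (cnto i w (w i)) b (cnto i w b) *
      ((W w - W (upd w i b)) * (G (W w) - G (W (upd w i b)))))).
    by rewrite ler_pM.
  rewrite WW' /= -!/(W _) le_eqVlt; apply/orP; left; apply/eqP.
  by ring.
(* [pair_sum p Q1] has mean [2 * V], so only its fluctuations and the Taylor remainder are left. *)
have main : 2 * V * (Ex (fun w => step z (W w)) - Phi z) =
    - Ex (fun w => (pair_sum p Q1 w - 2 * V) * D (W w)) - sig * Ex (bsum F err).
  have -> : Ex (fun w => step z (W w)) - Phi z =
      Ex (fun w => D (W w)) - Ex (fun w => W w * f (W w)).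
    rewrite -[X in _ - X = _](@Ex_cst _ n _ _ p_sum1) -!ExB.
    by apply: eq_Ex => w; rewrite /D; ring.
  rewrite mulrBr EWf -ExZ opprD addrA; congr (_ - _).
  by rewrite -ExB -ExN; apply: eq_Ex => w; ring.
have Q1_bound : `|Ex (fun w => (pair_sum p Q1 w - 2 * V) * D (W w))| <=
    2 * Num.sqrt (Var (pair_sum p Q1)).
  have VE : Var (fun w => pair_sum p Q1 w - 2 * V) = Var (pair_sum p Q1).
    rewrite /Var ExB Ex_cst// Ex_Q1; apply: eq_Ex => w; congr (_ ^+ 2).
    by rewrite /V; ring.
  rewrite -VE; apply: (Ex_mul_le (G := fun w => D (W w))) => //.
  by rewrite ExB Ex_cst// Ex_Q1 subrr.
have V2 : 0 < 2 * V by rewrite mulr_gt0.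
rewrite ler_pdivlMr// -(ler_pM2l (ltr0Sn R 1)) [_ * V]mulrC mulrA.
rewrite -[X in X * _](gtr0_norm V2) -normrM main.
apply: le_trans (ler_normB _ _) _; rewrite normrN mulrDr.
exact: lerD.
Qed.

Lemma kolmogorov_solution z : 0 < Var Y ->
  `|Ex (fun w => step z ((Y w - mu) / Num.sqrt (Var Y))) - Phi z| <=
  36 * K * Num.sqrt ((1 + gam) * intensity n p) / Var Y.
Proof.
move=> V0; apply: le_trans (kolmogorov_pair_sum z V0) _.
rewrite ler_wpM2r ?invr_ge0 ?(ltW V0)//.
have g0 : 0 <= gam.
  apply: gam_ge0; case: (pickP (@predT U)) => [a _|U0]; first by exists a.
  by exfalso; move: p_sum1; rewrite big_pred0// => /eqP; rewrite eq_sym oner_eq0.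
have K0 : 0 <= K by apply: K_ge0; rewrite addr_ge0.
have I0 : 0 <= (1 + gam) * intensity n p.
  rewrite mulr_ge0 ?addr_ge0// mulr_ge0 ?sqr_ge0// sumr_ge0// => a _.
  exact: sqr_ge0.
(* 12 is the square root of the 144 of [Var_pair_sum]; one such bound for [Q1] and two for [Q2] make
   36. *)
have b (Q : U -> nat -> U -> nat -> R) :
    (forall a k b l, `|Q a k b l| <= Fs a k b l * 2) ->
    Num.sqrt (Var (pair_sum p Q)) <= 12 * K * Num.sqrt ((1 + gam) * intensity n p).
  move=> /Q_le[q1 q2].
  have := Var_pair_sum p_gt0 p_sum1 lam_le K0 q1 q2.
  rewrite (_ : 144 * _ * _ * _ =
    (12 * K) ^+ 2 * ((1 + gam) * intensity n p)); last by ring.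
  move=> /ler_wsqrtr; rewrite sqrtrM ?sqr_ge0// sqrtr_sqr ger0_norm//.
  by rewrite mulr_ge0.
have := b _ Q1_le; have := b _ Q2_le.
lra.
Qed.

End stein_pair.

Lemma kolmogorov_noniso (R : realType) (gam : R) : exists A : R, 0 <= A /\
  forall n (U : finType) (p : U -> R), (0 < n)%N ->
  (forall a, 0 < p a) -> \sum_a p a = 1 -> (forall a, p a <= 2^-1) ->
  (forall a, n%:R * p a <= gam) -> 0 < Var p (@noniso R n U) ->
  forall z, `|Ex p (fun w : {ffun 'I_n -> U} =>
      step z ((noniso R w - Ex p (@noniso R n U)) /
        Num.sqrt (Var p (@noniso R n U)))) - Phi z| <=
    A * Num.sqrt (intensity n p) / Var p (@noniso R n U).
Proof.
have [C [C0 hC]] := urn_stein_solutions gam.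
exists (`|36 * (4 * C * (1 + gam)) * Num.sqrt (1 + gam)|); split => //.
move=> n U p n0 p0 p1 p2 pg V0 z.
have [h [c [h_eq h1]]] := hC n U p n0 p0 p2 pg.
apply: le_trans (kolmogorov_solution p0 p1 pg C0 h_eq h1 z V0) _.
rewrite ler_wpM2r ?invr_ge0 ?(ltW V0)//.
have g0 : 0 <= 1 + gam.
  rewrite addr_ge0//; case: (pickP (@predT U)) => [a _|U0].
    by apply: le_trans (pg a); rewrite mulr_ge0// ltW.
  by exfalso; move: p1; rewrite big_pred0// => /eqP; rewrite eq_sym oner_eq0.
rewrite (sqrtrM _ g0) [leLHS]mulrA.
by apply: ler_wpM2r; [exact: sqrtr_ge0|exact: ler_norm].
Qed.

(** * Lower bound on the variance *)

Section pairing.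
Context (R : realType) (U : finType) (p : U -> R).
Hypothesis p_ge0 : forall a, 0 <= p a.

Definition flat_pairs (L : seq (U * U)) : seq U :=
  flatten [seq [:: P.1; P.2] | P <- L].

(** The two largest, [x] and [y], are paired. Then [p x ^+ 2 <= M ^+ 2], while [p y ^+ 2] and the
    remainder of the induction hypothesis taken at [M := p y] are each at most [p x * p y]. *)
Let pairing_sorted (s : seq U) : sorted (fun a b => p b <= p a) s ->
  exists L, subseq (flat_pairs L) s /\
    forall M, (forall a, a \in s -> p a <= M) ->
    \sum_(a <- s) p a ^+ 2 <= 2 * \sum_(P <- L) p P.1 * p P.2 + M ^+ 2.
Proof.
have ge_trans : transitive (fun a b => p b <= p a).
  by move=> a b c ba cb; exact: le_trans cb ba.
have [m] := ubnP (size s); elim: m s => // m ih [|x [|y s]] sm s_sorted.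
- exists [::]; split=> // M _.
  by rewrite !big_nil mulr0 add0r sqr_ge0.
- exists [::]; split=> // M sM.
  rewrite big_nil mulr0 add0r big_cons big_nil addr0.
  have px : p x <= M by rewrite sM ?mem_head.
  by rewrite ler_sqr ?nnegrE// (le_trans (p_ge0 x)).
- have := s_sorted; rewrite /= => /andP[yx ys].
  have s'_sorted : sorted (fun a b => p b <= p a) s := path_sorted ys.
  have [|L [Ls LM]] := ih s _ s'_sorted.
    by move: sm; rewrite /= !ltnS => /ltnW.
  exists ((x, y) :: L); split; first by rewrite /flat_pairs/= !eqxx.
  move=> M sM; rewrite !big_cons/=.
  have h : \sum_(a <- s) p a ^+ 2 <= 2 * \sum_(P <- L) p P.1 * p P.2 + p y ^+ 2.
    apply: LM => a sa; move: ys.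
    by rewrite path_sortedE// => /andP[/allP/(_ _ sa)].
  have px : p x <= M by rewrite sM ?mem_head.
  have px2 : p x ^+ 2 <= M ^+ 2.
    by rewrite ler_sqr ?nnegrE// (le_trans (p_ge0 x)).
  have pxy : p y ^+ 2 <= p x * p y by rewrite expr2 ler_wpM2r.
  lra.
Qed.

Lemma flat_pairs_neq (L : seq (U * U)) P :
  uniq (flat_pairs L) -> P \in L -> P.1 != P.2.
Proof.
elim: L => // -[x y] L ih; rewrite /flat_pairs/= inE negb_or -/(flat_pairs L).
move=> /andP[/andP[xy _] /andP[_ uL]].
by rewrite inE => /predU1P[->//|]; exact: ih.
Qed.

Lemma exists_pairing : exists L : seq (U * U), uniq (flat_pairs L) /\
  forall M, (forall a, p a <= M) ->
  \sum_a p a ^+ 2 <= 2 * \sum_(P <- L) p P.1 * p P.2 + M ^+ 2.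
Proof.
pose s := sort (fun a b => p b <= p a) (enum U).
have s_sorted : sorted (fun a b => p b <= p a) s.
  by apply: sort_sorted => a b; exact: le_total.
have [L [Ls LM]] := pairing_sorted s_sorted.
exists L; split; first by apply: subseq_uniq Ls _; rewrite sort_uniq enum_uniq.
move=> M pM; apply: le_trans (LM _ (fun a _ => pM a)).
by rewrite (perm_big _ (permEl (perm_sort _ _)))/= big_enum.
Qed.

End pairing.

(** * Test functions attached to pairs of urns *)

Section variance_lower_bound.
Context (R : realType) (n : nat) (U : finType) (p : U -> R).
Hypothesis p_gt0 : forall a, 0 < p a.
Hypothesis p_sum1 : \sum_a p a = 1.

Let p_ge0 a : 0 <= p a. Proof. exact: ltW. Qed.

Notation Omega := {ffun 'I_n -> U}.
Notation Ex := (@Ex R n U p).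
Notation Var := (@Var R n U p).
Notation Y := (@noniso R n U).

Implicit Types (w : Omega) (i j : 'I_n) (a b x y : U).

Let Ex_sum2 (f : 'I_n -> 'I_n -> Omega -> R) :
  Ex (fun w => \sum_i \sum_(j | j != i) f i j w) =
  \sum_i \sum_(j | j != i) Ex (f i j).
Proof. by rewrite Ex_sum; apply: eq_bigr => i _; rewrite Ex_sum. Qed.

Section test_function.
Context (x y : U).
Hypothesis xy : x != y.

Definition hit a : bool := (a == x) || (a == y).

(* The value that makes swap_kernel integrate to 0 against p x p. *)
Definition swap_coef : R := 2 * p x * p y / (p x ^+ 2 + p y ^+ 2).

Definition swap_kernel a b : R :=
  (hit a)%:R * (hit b)%:R * (if a == b then - swap_coef else 1).

Definition free_rest i j w : R :=
  ((\sum_(k | (k != i) && (k != j)) hit (w k))%N == 0%N)%:R.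

(** Nonzero only if exactly two balls lie in {x, y}: 2 if they are apart, [- 2 * swap_coef] if
    together, each pair being counted in both orders. *)
Definition swap_test w : R :=
  \sum_i \sum_(j | j != i) free_rest i j w * swap_kernel (w i) (w j).

Definition swap_mass : R :=
  p x * p y * \sum_i \sum_(j | j != i) Ex (free_rest i j).

Let sq_gt0 : 0 < p x ^+ 2 + p y ^+ 2.
Proof. by rewrite addr_gt0// exprn_gt0. Qed.

Let coef_itv : 0 <= swap_coef <= 1.
Proof.
rewrite divr_ge0 ?mulr_ge0 ?(ltW sq_gt0)//= ler_pdivrMr// mul1r.
by have := sqr_ge0 (p x - p y); lra.
Qed.

Let coefE : swap_coef * (p x ^+ 2 + p y ^+ 2) = 2 * p x * p y.
Proof. by rewrite divfK// lt0r_neq0. Qed.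

Let sum_hit (f : U -> R) : \sum_a p a * ((hit a)%:R * f a) =
  p x * f x + p y * f y.
Proof.
rewrite (bigD1 x)//= (bigD1 y) 1?eq_sym//= /hit !eqxx/= orbT !mul1r.
rewrite big1 ?addr0// => a /andP[ax ay].
by rewrite (negbTE ax) (negbTE ay) mul0r mulr0.
Qed.

Let free_rest_upd i j w a b :
  free_rest i j (upd (upd w i a) j b) = free_rest i j w.
Proof.
congr (nat_of_bool (_ == _))%:R; apply: eq_bigr => k /andP[ki kj].
by rewrite !upd_neq.
Qed.

(** Balls [i] and [j] are averaged out: [free_rest] ignores them, and [G] is constant as long as
    both stay in {x, y}, so the kernel integrates separately. *)
Let Ex_swap_term i j (G : Omega -> R) (K : U -> U -> R) : i != j ->
  (forall w a b, hit a -> hit b ->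
    G (upd (upd w i a) j b) = G (upd (upd w i x) j x)) ->
  Ex (fun w => free_rest i j w * ((hit (w i))%:R * (hit (w j))%:R *
     K (w i) (w j)) * G w) =
  (p x ^+ 2 * K x x + p x * p y * (K x y + K y x) + p y ^+ 2 * K y y) *
  Ex (fun w => free_rest i j w * G (upd (upd w i x) j x)).
Proof.
move=> ij GE; rewrite -(Ex_avg p_sum1 j) -(Ex_avg p_sum1 i) -ExZ.
apply: eq_Ex => w; rewrite /avg.
transitivity (\sum_a p a * ((hit a)%:R * (\sum_b p b * ((hit b)%:R *
    (K a b * (free_rest i j w * G (upd (upd w i x) j x))))))).
  apply: eq_bigr => a _; rewrite !mulr_sumr; apply: eq_bigr => b _.
  rewrite upd_same (upd_neq _ _ ij) upd_same free_rest_upd.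
  case ha : (hit a); last by rewrite !(mul0r, mulr0).
  case hb : (hit b); last by rewrite !(mul0r, mulr0).
  by rewrite GE ?ha ?hb//; ring.
rewrite sum_hit !sum_hit; ring.
Qed.

Definition swap_invariant (G : Omega -> R) :=
  forall w k, G (upd w k x) = G (upd w k y).

Let hitP a : hit a -> a = x \/ a = y.
Proof. by rewrite /hit => /orP[]/eqP ->; [left|right]. Qed.

Let swap_invariant_upd (G : Omega -> R) i j : swap_invariant G ->
  forall w a b, hit a -> hit b ->
    G (upd (upd w i a) j b) = G (upd (upd w i x) j x).
Proof.
move=> GI w a b ha hb.
have H1 w' k c : hit c -> G (upd w' k c) = G (upd w' k x).
  by move=> /hitP[->//|->]; rewrite GI.
rewrite H1//; have [->|ij] := eqVneq i j; first by rewrite !upd_upd.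
by rewrite upd_comm// H1// upd_comm// eq_sym.
Qed.

Lemma swap_test_orthogonal (G : Omega -> R) :
  swap_invariant G -> Ex (fun w => swap_test w * G w) = 0.
Proof.
move=> GI.
transitivity (\sum_i \sum_(j | j != i) Ex (fun w =>
    free_rest i j w * swap_kernel (w i) (w j) * G w)).
  rewrite -Ex_sum2; apply: eq_Ex => w; rewrite mulr_suml; apply: eq_bigr => i _.
  by rewrite mulr_suml.
rewrite big1// => i _; rewrite big1// => j ji.
rewrite (Ex_swap_term (fun a b => if a == b then - swap_coef else 1)).
- rewrite !eqxx (negbTE xy) eq_sym (negbTE xy).
  rewrite (_ : _ + _ + _ = 2 * p x * p y - swap_coef * (p x ^+ 2 + p y ^+ 2)).
    by rewrite coefE subrr mul0r.
  by ring.
- by rewrite eq_sym.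
- exact: swap_invariant_upd.
Qed.

Let rest w : R := \sum_(z | (z != x) && (z != y)) excess R (cnt w z).

Let rest_invariant : swap_invariant rest.
Proof.
move=> w k; apply: eq_bigr => z /andP[zx zy]; congr (excess R _).
apply: eq_bigr => l _; rewrite !updE; case: (l == k) => //.
by rewrite ![_ == z]eq_sym (negbTE zx) (negbTE zy).
Qed.

Let noniso_split w i j : i != j -> free_rest i j w != 0 ->
  hit (w i) -> hit (w j) -> Y w = rest w + 2 * (w i == w j)%:R.
Proof.
move=> ij f0 hi hj; rewrite nonisoE (bigD1 x)//= (bigD1 y) 1?eq_sym//=.
rewrite addrCA addrA addrC; congr (_ + _).
have too z : hit z -> cntoo i j w z = 0%N.
  move=> hz; move: f0; rewrite pnatr_eq0 eqb0 negbK sum_nat_eq0 => /forallP f0.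
  apply/eqP; rewrite sum_nat_eq0; apply/forallP => k; apply/implyP => kij.
  have := f0 k; rewrite kij/= /hit eqb0 negb_or => /andP[kx ky].
  by rewrite eqb0; have [->|->] := hitP hz.
have cntz z : hit z -> cnt w z = ((w i == z) + (w j == z))%N.
  move=> hz; rewrite (cntE i) (cntoE _ _ ij) too// add0n addnC.
  by [].
have hx : hit x by rewrite /hit eqxx.
have hy : hit y by rewrite /hit eqxx orbT.
rewrite !cntz// /excess.
have yx : y != x by rewrite eq_sym.
by have [->|->] := hitP hi; have [->|->] := hitP hj;
   rewrite ?eqxx ?(negbTE xy) ?(negbTE yx)/=; ring.
Qed.

(** Where a term of the test is nonzero, [Y] is [rest], to which the test is orthogonal, plus 2 if
    the two balls share an urn; only the diagonal of the kernel survives. *)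
Lemma swap_test_cov : Ex (fun w => swap_test w * Y w) = - 4 * swap_mass.
Proof.
have -> : Ex (fun w => swap_test w * Y w) =
    Ex (fun w => swap_test w * rest w) + \sum_i \sum_(j | j != i) Ex (fun w =>
    free_rest i j w * ((hit (w i))%:R * (hit (w j))%:R *
      (if w i == w j then - 2 * swap_coef else 0)) * 1).
  rewrite -Ex_sum2 -ExD; apply: eq_Ex => w; rewrite !mulr_suml -big_split.
  apply: eq_bigr => i _; rewrite !mulr_suml -big_split.
  apply: eq_bigr => j ji /=; rewrite /swap_kernel.
  have [->|f0] := eqVneq (free_rest i j w) 0; first by rewrite !mul0r addr0.
  case hi : (hit (w i)); last by rewrite !(mul0r, mulr0) addr0.
  case hj : (hit (w j)); last by rewrite !(mul0r, mulr0) addr0.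
  have ij : i != j by rewrite eq_sym.
  rewrite (noniso_split ij f0 hi hj).
  by case: (_ == _); rewrite /= ?mulr1n ?mulr0n; ring.
rewrite swap_test_orthogonal// add0r /swap_mass !mulr_sumr.
apply: eq_bigr => i _; rewrite !mulr_sumr; apply: eq_bigr => j ji.
rewrite (Ex_swap_term (G := fun=> 1)
  (fun a b => if a == b then - 2 * swap_coef else 0)) ?(eq_sym i)//.
rewrite !eqxx (negbTE xy) eq_sym (negbTE xy) addr0 mulr0 addr0.
rewrite (_ : _ + _ = - 2 * (swap_coef * (p x ^+ 2 + p y ^+ 2))); last by ring.
rewrite coefE (_ : Ex (fun w => free_rest i j w * 1) = Ex (free_rest i j)).
  by ring.
by apply: eq_Ex => w; rewrite mulr1.
Qed.

Let swap_abs w : R := \sum_i \sum_(j | j != i) free_rest i j w *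
  ((hit (w i))%:R * (hit (w j))%:R * (if w i == w j then swap_coef else 1)).

Let kernel_abs a b : `|swap_kernel a b| =
  (hit a)%:R * (hit b)%:R * (if a == b then swap_coef else 1).
Proof.
have /andP[c0 c1] := coef_itv.
rewrite /swap_kernel !normrM !normr_nat; congr (_ * _).
by case: eqP; rewrite ?normrN ?normr1// ger0_norm.
Qed.

Let swap_test_abs w : `|swap_test w| <= swap_abs w.
Proof.
apply: le_trans (ler_norm_sum _ _ _) _; apply: ler_sum => i _.
apply: le_trans (ler_norm_sum _ _ _) _; apply: ler_sum => j _.
by rewrite normrM kernel_abs ger0_norm.
Qed.

(** Terms survive only when [N], the number of balls in {x, y}, is 2, and there are then
    [N ^+ 2 - N = 2] ordered pairs. *)
Let swap_abs_le w : swap_abs w <= 2.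
Proof.
pose N := (\sum_k hit (w k))%N.
have /andP[c0 c1] := coef_itv.
have split_N i j : j != i -> N =
    (\sum_(k | (k != i) && (k != j)) hit (w k) + hit (w j) + hit (w i))%N.
  move=> ji; rewrite /N (bigD1 i)//= (bigD1 j)//= addnC.
  by congr (_ + _)%N; exact: addnC.
have term i j : j != i -> free_rest i j w * ((hit (w i))%:R * (hit (w j))%:R *
    (if w i == w j then swap_coef else 1)) <=
    (N == 2)%:R * ((hit (w i))%:R * (hit (w j))%:R).
  move=> ji; rewrite /free_rest (split_N _ _ ji).
  have h2 : (if w i == w j then swap_coef else 1) <= 1 by case: ifP.
  have h3 : 0 <= (if w i == w j then swap_coef else 1) by case: ifP.
  case: (hit (w i)); last by rewrite !(mul0r, mulr0).
  case: (hit (w j)); last by rewrite !(mul0r, mulr0).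
  rewrite !addn1 !eqSS; case: (_ == 0)%N; rewrite ?mul0r//.
  by rewrite !mul1r.
have sums : \sum_i \sum_(j | j != i) ((hit (w i))%:R * (hit (w j))%:R) =
    N%:R ^+ 2 - N%:R :> R.
  have NE : N%:R = \sum_i (hit (w i))%:R :> R by rewrite natr_sum.
  rewrite expr2 {1 3}NE mulr_suml -sumrB; apply: eq_bigr => i _.
  rewrite NE mulr_sumr [in RHS](bigD1 i)//= -natrM mulnb andbb addrC addrK.
  by [].
apply: (@le_trans _ _ ((N == 2)%:R * (N%:R ^+ 2 - N%:R))).
  rewrite -sums mulr_sumr; apply: ler_sum => i _; rewrite mulr_sumr.
  by apply: ler_sum => j ji; exact: term.
by case: eqP => [->|_]; rewrite ?mul0r// mul1r; lra.
Qed.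

(** The square is at most [2 * swap_abs], and [swap_abs] has mean [4 * swap_mass], half of it from
    the diagonal by the choice of [swap_coef]. *)
Lemma swap_test_sqr : Ex (fun w => swap_test w ^+ 2) <= 8 * swap_mass.
Proof.
apply: (@le_trans _ _ (Ex (fun w => 2 * swap_abs w))).
  apply: ler_Ex => // w; rewrite -real_normK ?num_real// expr2.
  have h := swap_test_abs w.
  by rewrite ler_pM// (le_trans h (swap_abs_le w)).
rewrite ExZ (_ : 8 = 2 * 4 :> R); last by ring.
rewrite -mulrA ler_wpM2l// le_eqVlt; apply/orP; left; apply/eqP.
rewrite Ex_sum /swap_mass !mulr_sumr.
apply: eq_bigr => i _; rewrite Ex_sum !mulr_sumr; apply: eq_bigr => j ji.
have := Ex_swap_term (G := fun=> 1) (i := i) (j := j)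
  (fun a b => if a == b then swap_coef else 1).
rewrite eq_sym => /(_ ji (fun _ _ _ _ _ => erefl)).
rewrite !eqxx (negbTE xy) eq_sym (negbTE xy).
rewrite (_ : _ + _ + _ =
  2 * p x * p y + swap_coef * (p x ^+ 2 + p y ^+ 2)); last by ring.
rewrite coefE (_ : Ex (fun w => free_rest i j w * 1) = Ex (free_rest i j)); last first.
  by apply: eq_Ex => w; rewrite mulr1.
rewrite (_ : 4 * _ =
  (2 * p x * p y + 2 * p x * p y) * Ex (free_rest i j)); last by ring.
by move=> <-; apply: eq_Ex => w; rewrite mulr1.
Qed.

(** A product over the balls of independent factors, each of mean 1 or [1 - (p x + p y)], hence at
    least [q]. *)
Lemma free_rest_lower (q : R) i j : 0 <= q -> q <= 1 - (p x + p y) ->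
  q ^+ n <= Ex (free_rest i j).
Proof.
move=> q0 qp.
pose g (k : 'I_n) a : R :=
  if (k != i) && (k != j) then 1 - (hit a)%:R else 1.
have -> : Ex (free_rest i j) = Ex (fun w => \prod_k g k (w k)).
  apply: eq_Ex => w; rewrite /free_rest sum_nat_eq0.
  have [/forallP h|] := boolP [forall (k | (k != i) && (k != j)),
      nat_of_bool (hit (w k)) == 0%N].
    rewrite big1// => k _; rewrite /g; case: ifP => // kij.
    by have := h k; rewrite kij/= => /eqP ->; rewrite subr0.
  rewrite negb_forall => /existsP[k]; rewrite negb_imply => /andP[kij hk].
  rewrite (bigD1 k)//= /g kij.
  by move: hk; rewrite eqb0 negbK => ->; rewrite subrr mul0r.
rewrite (Ex_prod p g) -[n in q ^+ n]card_ord -prodr_const.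
apply: ler_prod => k _; rewrite q0/= /g.
case: ((k != i) && (k != j)); last first.
  under eq_bigr do rewrite mulr1; rewrite p_sum1.
  by apply: (le_trans qp); rewrite lerBlDr lerDl addr_ge0.
under eq_bigr do rewrite mulrBr mulr1 -[X in _ - p _ * X]mulr1.
by rewrite sumrB p_sum1 sum_hit !mulr1.
Qed.

End test_function.

Lemma swap_test_invariant x y x' y' :
  x != x' -> x != y' -> y != x' -> y != y' ->
  swap_invariant x y (swap_test x' y').
Proof.
move=> xx' xy' yx' yy' w k; rewrite /swap_test.
have hx : hit x' y' x = false by rewrite /hit (negbTE xx') (negbTE xy').
have hy : hit x' y' y = false by rewrite /hit (negbTE yx') (negbTE yy').
apply: eq_bigr => i _; apply: eq_bigr => j _; congr (_ * _).
  congr (nat_of_bool (_ == _))%:R; apply: eq_bigr => l _.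
  by rewrite !updE; case: eqP; rewrite // hx hy.
rewrite /swap_kernel !updE.
by case: (i == k); case: (j == k); rewrite ?hx ?hy ?(mul0r, mulr0).
Qed.

(** The tests of disjoint pairs are mutually orthogonal, so their sum has second moment at most
    [8 * A] and covariance [- 4 * A] with [Y]; Cauchy-Schwarz then yields [2 * A]. *)
Lemma Var_pairs_le (L : seq (U * U)) : uniq (flat_pairs L) ->
  2 * \sum_(P <- L) swap_mass P.1 P.2 <= Var Y.
Proof.
pose Z L' w := \sum_(P <- L') swap_test P.1 P.2 w.
have ZE L' : uniq (flat_pairs L') ->
    [/\ Ex (Z L') = 0,
        Ex (fun w => Z L' w * Y w) = - 4 * \sum_(P <- L') swap_mass P.1 P.2 &
        Ex (fun w => Z L' w ^+ 2) <= 8 * \sum_(P <- L') swap_mass P.1 P.2].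
  elim: L' => [|[x y] L' ih].
    move=> _; rewrite big_nil !mulr0; split.
    - rewrite -[RHS](@Ex_cst _ n _ _ p_sum1); apply: eq_Ex => w.
      by rewrite /Z big_nil.
    - rewrite -[RHS](@Ex_cst _ n _ _ p_sum1); apply: eq_Ex => w.
      by rewrite /Z big_nil mul0r.
    - rewrite -[leRHS](@Ex_cst _ n _ _ p_sum1); apply: ler_Ex => // w.
      by rewrite /Z big_nil expr0n.
  rewrite /flat_pairs /= inE negb_or -/(flat_pairs L').
  move=> /andP[/andP[xy xL] /andP[yL uL]].
  have [Z0 ZY Z2] := ih uL.
  have ZC w : Z ((x, y) :: L') w = swap_test x y w + Z L' w by rewrite /Z big_cons.
  have inv : swap_invariant x y (Z L').
    move=> w k; rewrite /Z big_seq [RHS]big_seq; apply: eq_bigr => P PL.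
    have [P1 P2] : P.1 \in flat_pairs L' /\ P.2 \in flat_pairs L'.
      by split; apply/flattenP; exists [:: P.1; P.2];
        rewrite ?inE ?eqxx ?orbT//; apply: map_f.
    apply: swap_test_invariant; first by apply: contraNneq xL => ->.
    - by apply: contraNneq xL => ->.
    - by apply: contraNneq yL => ->.
    - by apply: contraNneq yL => ->.
  rewrite !big_cons/=; split.
  - rewrite (eq_Ex p ZC) ExD Z0 addr0.
    rewrite -(swap_test_orthogonal xy (G := fun=> 1))//.
    by apply: eq_Ex => w; rewrite mulr1.
  - rewrite mulrDr -ZY -(swap_test_cov xy) -ExD; apply: eq_Ex => w.
    by rewrite ZC mulrDl.
  - rewrite mulrDr; apply: le_trans (lerD (swap_test_sqr xy) Z2).
    rewrite (_ : Ex _ = Ex (fun w => swap_test x y w ^+ 2 + Z L' w ^+ 2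
        + 2 * (swap_test x y w * Z L' w))).
      by rewrite !ExD ExZ swap_test_orthogonal// mulr0 addr0.
    by apply: eq_Ex => w; rewrite ZC; ring.
move=> uL; have [Z0 ZY Z2] := ZE L uL.
set A := \sum_(P <- L) _ in ZY Z2 *.
have A0 : 0 <= A.
  have : 0 <= 8 * A by apply: le_trans Z2; apply: Ex_ge0 => // w; exact: sqr_ge0.
  by rewrite pmulr_rge0.
have [->|A_neq0] := eqVneq A 0; first by rewrite mulr0 Var_ge0.
have A_gt0 : 0 < A by rewrite lt_neqAle eq_sym A_neq0.
have := Ex_CS p_ge0 (Z L) (fun w => Y w - Ex Y).
rewrite (_ : Ex (fun w => Z L w * _) = - 4 * A); last first.
  rewrite -ZY -[RHS]subr0 -(mulr0 (Ex Y)) -Z0 -ExZ -ExB.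
  by apply: eq_Ex => w; ring.
move=> /le_trans/(_ (ler_wpM2r (Var_ge0 p_ge0 _) Z2)).
rewrite -/(Var Y) (_ : (- 4 * A) ^+ 2 = 8 * A * (2 * A)); last by ring.
by rewrite ler_pM2l// mulr_gt0.
Qed.

End variance_lower_bound.

Lemma Var_noniso_ge (R : realType) (gam : R) n (U : finType) (p : U -> R) :
  (2 <= n)%N -> (forall a, 0 < p a) -> \sum_a p a = 1 ->
  (forall a, p a <= 4^-1) -> (forall a, n%:R * p a <= gam) ->
  expR (- (4 * gam)) / 2 * (intensity n p - gam ^+ 2) <=
  Var p (@noniso R n U).
Proof.
move=> n2 p0 p1 p4 pg.
have p_ge0 a : 0 <= p a by exact: ltW.
have [L [uL LM]] := exists_pairing p_ge0.
apply: le_trans (@Var_pairs_le R n U p p0 p1 L uL).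
have n0 : 0 < n%:R :> R by rewrite ltr0n ltnW.
have h1 : intensity n p - gam ^+ 2 <=
    2 * (n%:R ^+ 2 * \sum_(P <- L) p P.1 * p P.2).
  (* The largest probability is at most [gam / n]; scaled by [n ^+ 2], the unpaired remainder
     becomes [gam ^+ 2]. *)
  have := LM (gam / n%:R) (fun a => _).
  have h a : p a <= gam / n%:R by rewrite ler_pdivlMr// mulrC.
  move=> /(_ h); rewrite -(ler_pM2l (exprn_gt0 2 n0)) /intensity.
  rewrite mulrDr -exprMn [n%:R * (_ / _)]mulrC divfK ?gt_eqF//; lra.
set b := expR _; have b0 : 0 < b by exact: expR_gt0.
apply: (@le_trans _ _ (b / 2 * (2 * (n%:R ^+ 2 * \sum_(P <- L) p P.1 * p P.2)))).
  by rewrite ler_wpM2l// divr_ge0// ltW.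
rewrite (_ : b / 2 * _ =
  2 * (b / 2 * n%:R ^+ 2 * \sum_(P <- L) p P.1 * p P.2)); last by field.
rewrite ler_wpM2l// mulr_sumr big_seq [leRHS]big_seq.
apply: ler_sum => -[x y] /(flat_pairs_neq uL) /= xy.
rewrite /swap_mass mulrC ler_wpM2l ?mulr_ge0//.
pose u := p x + p y.
have u0 : 0 <= u by rewrite addr_ge0.
have u2 : u <= 2^-1 by have := p4 x; have := p4 y; rewrite /u; lra.
(* [1 - u >= expR (- (2 * u))] for [u <= 1/2], and [n * u <= 2 * gam]. *)
have bq : b <= (1 - u) ^+ n.
  have h2 : expR (- (2 * u)) <= 1 - u.
    rewrite expRN -[leRHS]invrK lef_pV2 ?posrE ?invr_gt0 ?expR_gt0//; last by lra.
    apply: le_trans (expR_ge1Dx _); have u1 : 0 < 1 - u by lra.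
    by rewrite -[leLHS]mul1r ler_pdivrMr//; nra.
  apply: (@le_trans _ _ (expR (- (2 * u)) ^+ n)); last first.
    by rewrite lerXn2r ?nnegrE ?expR_ge0//; lra.
  rewrite -expRM_natl /b ler_expR mulrN lerN2.
  by have := pg x; have := pg y; rewrite /u; lra.
have free (i j : 'I_n) : b <= Ex p (free_rest R x y i j).
  apply: le_trans bq _; apply: free_rest_lower => //; rewrite -?/u; lra.
apply: (@le_trans _ _ (\sum_(i < n) \sum_(j < n | j != i) b)); last first.
  by apply: ler_sum => i _; apply: ler_sum => j _.
have -> : \sum_(i < n) \sum_(j < n | j != i) b = n%:R * ((n%:R - 1) * b).
  rewrite -sum_ord_cst; apply: eq_bigr => i _.
  have := sum_ord_cst n b; rewrite (bigD1 i)//= mulrBl mul1r => <-.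
  by rewrite addrAC subrr add0r.
have n2R : 2 <= n%:R :> R by rewrite ler_nat.
(* For [n >= 2] the [n * (n - 1)] ordered pairs number at least half of [n ^+ 2]. *)
have : 0 <= (n%:R - 2) * (n%:R * b) by rewrite mulr_ge0 ?subr_ge0// mulr_ge0// ltW.
by rewrite expr2; lra.
Qed.

(** * From the probability space to configurations *)

Section law_of_balls.
Context (R : realType) d (T : measurableType d) (P : probability T R).
Context (n m : nat) (p : 'I_m -> R) (X : 'I_n -> {RV P >-> nat}).
Hypothesis p_sum1 : \sum_x p x = 1.
Hypothesis X_pmf : forall i (x : 'I_m),
  P [set w | X i w = x :> nat] = (p x)%:E.
Hypothesis X_indep : mutually_independent X.

Notation Omega := {ffun 'I_n -> 'I_m}.

Let cell (w : Omega) : set T := [set t | forall i, X i t = w i :> nat].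

Let cellE w : cell w =
  \bigcap_(i in [set` [set: 'I_n]%SET]) (X i @^-1` [set (w i : nat)]).
Proof.
apply/seteqP; split=> [t ct i _|t ct i]; first exact: ct.
by apply: ct; rewrite /= inE.
Qed.

Let measurable_cell w : measurable (cell w).
Proof.
rewrite cellE; apply: fin_bigcap_measurable => [|i _].
  exact: finite_finset.
by rewrite -[X in measurable X]setTI; exact: measurable_funP.
Qed.

Let P_cell w : P (cell w) = (wt p w)%:E.
Proof.
rewrite cellE X_indep// /wt -prodEFin; apply: eq_big => [i|i _]; rewrite ?inE//.
exact: X_pmf.
Qed.

Let trivIset_cell (D : set Omega) : trivIset D cell.
Proof.
apply/trivIsetP => w w' _ _ ww'; apply/seteqP; split=> // t [ct ct'].
case/eqP: ww'; apply/ffunP => i; apply: val_inj.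
by rewrite /= -ct ct'.
Qed.

Let cells := \big[setU/set0]_(w <- index_enum Omega) cell w.

Let measurable_cells : measurable cells.
Proof. by apply: bigsetU_measurable => w _; exact: measurable_cell. Qed.

Let integral_cells (g : T -> R) (G : Omega -> R) : measurable_fun setT g ->
  (forall w t, cell w t -> g t = G w) ->
  (\int[P]_(t in cells) (g t)%:E)%E = (Ex p G)%:E.
Proof.
move=> mg gG; rewrite integral_bigsetU_EFin//.
- rewrite /Ex -sumEFin; apply: eq_bigr => w _.
  transitivity (\int[P]_(t in cell w) (G w)%:E)%E.
    by apply: eq_integral => t; rewrite inE => /gG ->.
  transitivity ((G w)%:E * P (cell w))%E; first exact: integral_cst.
  by rewrite P_cell -EFinM mulrC.
- exact: index_enum_uniq.
- by apply/measurable_EFinP; exact: measurable_funS mg.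
Qed.

(** The weights of the configurations sum to 1, so natural-number labels outside the range of ['I_m]
    are charged only on a null set. *)
Let P_cells : P cells = 1%E.
Proof.
have := @integral_cells (cst 1) (fun=> 1) (measurable_cst _) (fun _ _ _ => erefl).
rewrite Ex_cst// => <-.
by rewrite -[LHS]mul1e; exact/esym/(integral_cst P measurable_cells 1%:E).
Qed.

Lemma expectation_balls (g : T -> R) (G : Omega -> R) : measurable_fun setT g ->
  (forall (w : Omega) t, (forall i, X i t = w i :> nat) -> g t = G w) ->
  ('E_P[g] = (Ex p G)%:E)%E.
Proof.
move=> mg gG; rewrite -(integral_cells mg gG) unlock [RHS]integral_mkcond.
apply: ae_eq_integral => //.
- exact/measurable_EFinP.
- apply/(measurable_restrictT _ _).1 => //; apply/measurable_EFinP.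
  exact: measurable_funS mg.
- exists (~` cells); split.
  + exact: measurableC.
  + transitivity (1 - P cells)%E; first exact: probability_setC.
    by rewrite P_cells subee.
  + move=> t /=; apply: contra_not => ct _.
    by rewrite patchE mem_set.
Qed.

Let Y : {RV P >-> R} := non_isolated X.

Lemma non_isolated_noniso (w : Omega) t : (forall i, X i t = w i :> nat) ->
  Y t = noniso R w.
Proof.
move=> ct; rewrite /Y/= /non_isolated natr_sum; apply: eq_bigr => i _.
rewrite /nb_others; congr (nat_of_bool (0 < _)%N)%:R.
rewrite (eq_bigr (fun j => (w j == w i) : nat)); last first.
  by move=> j _; rewrite !ct.
by have := cntE i w (w i); rewrite /cnt eqxx addn1 => ->.
Qed.

Lemma expectation_non_isolated : ('E_P[Y] = (Ex p (@noniso R n _))%:E)%E.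
Proof. by apply: expectation_balls => //; exact: non_isolated_noniso. Qed.

Lemma stddev_non_isolated : stddev P Y = Num.sqrt (Var p (@noniso R n _)).
Proof.
rewrite /stddev /variance covariance.unlock expectation_non_isolated/=.
rewrite (@expectation_balls _ (fun w => (noniso R w - Ex p (@noniso R n _)) ^+ 2)) //.
by move=> w t /non_isolated_noniso Yt; rewrite expr2 /= /GRing.mul/= Yt.
Qed.

Lemma cdf_non_isolated z :
  cdf (standardize P Y : {RV P >-> R}) z =
  (Ex p (fun w : Omega => step z ((noniso R w - Ex p (@noniso R n _)) /
     Num.sqrt (Var p (@noniso R n _)))))%:E.
Proof.
pose A := (standardize P Y : {RV P >-> R}) @^-1` `]-oo, z].
have mA : measurable A.
  by rewrite /A -[X in measurable X]setTI; exact: measurable_funP.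
rewrite /cdf /distribution /pushforward -/A -expectation_indic//.
apply: expectation_balls => [|w t /non_isolated_noniso Yt].
  exact: measurable_indic.
rewrite indicE /step -Yt -stddev_non_isolated -[Ex p _]/(fine (Ex p _)%:E).
rewrite -expectation_non_isolated; congr (nat_of_bool _)%:R.
by apply/idP/idP; rewrite inE /A/= in_itv.
Qed.

End law_of_balls.

(** * Integer values *)

Section lattice.
Context (R : realType) (n : nat) (U : finType) (p : U -> R).
Context (e sig : R).

Definition std_cdf (z : R) : R :=
  Ex p (fun w : {ffun 'I_n -> U} => step z ((noniso R w - e) / sig)).

(** If both intervals contained a value of the standardized variable, two values of [noniso], which
    are integers, would differ by less than 1 and more than 0. *)
Lemma std_cdf_lattice x y z : 0 <= sig -> x <= y -> y <= z ->
  (z - x) * sig < 1 -> std_cdf y = std_cdf x \/ std_cdf z = std_cdf y.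
Proof.
move=> sig0 xy yz gap; pose W (w : {ffun 'I_n -> U}) := (noniso R w - e) / sig.
have flat a b : a <= b -> (forall w, ~~ (a < W w <= b)) -> std_cdf b = std_cdf a.
  move=> ab h; apply: eq_Ex => w; rewrite /step -/(W w).
  congr (nat_of_bool _)%:R; have := h w.
  by case: (leP (W w) a) => [Wa _|_ /=]; [rewrite (le_trans Wa ab)|move/negbTE].
case: (pselect (exists w, x < W w <= y)) => [[w /andP[xw wy]]|nxy]; last first.
  by left; apply: flat => // w; apply/negP => h; apply: nxy; exists w.
right; apply: flat => // w'; apply/negP => /andP[yw' w'z].
have ww' : W w < W w' by exact: le_lt_trans wy yw'.
(* If [sig] were 0, division by zero would make [W] constant. *)
have sig_gt0 : 0 < sig.
  rewrite lt_neqAle sig0 andbT; apply: contraTneq ww' => s0.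
  by rewrite /W -s0 invr0 !mulr0 ltxx.
have E u : noniso R u = W u * sig + e by rewrite /W divfK ?gt_eqF// subrK.
have /andP[d0 d1] : 0 < noniso R w' - noniso R w < 1.
  rewrite !E (_ : _ - _ = (W w' - W w) * sig); last by ring.
  rewrite mulr_gt0 ?subr_gt0//=; apply: le_lt_trans gap.
  by rewrite ler_wpM2r// lerB// ltW.
have N u : noniso R u = (\sum_(i < n) (0 < cnto i u (u i)))%N%:R by rewrite natr_sum.
move: d0 d1; rewrite !N subr_gt0 ltr_nat ltrBlDl natr1 ltr_nat ltnS => /leq_trans h /h.
by rewrite ltnn.
Qed.

(** [std_cdf] is constant across one of the two steps of length [del], while [Phi] grows there by at
    least [del * gauss 1], the steps lying in [0, 1]. *)
Lemma std_cdf_far (K del : R) : 0 <= sig -> 0 < del -> 2 * del <= 1 ->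
  2 * del * sig < 1 -> (forall t, t \in [:: 0; del; 2 * del] ->
    `|std_cdf t - Phi t| <= K) -> del * gauss 1 <= 2 * K.
Proof.
move=> sig0 del0 del1 gap FK.
have h0 := FK 0; have h1 := FK del; have h2 := FK (2 * del).
move: h0 h1 h2; rewrite !inE !eqxx !orbT => /(_ isT) h0 /(_ isT) h1 /(_ isT) h2.
move: h0 h1 h2; rewrite !ler_norml => /andP[a1 a2] /andP[b1 b2] /andP[c1 c2].
have i1 : del * gauss 1 <= Phi del - Phi 0.
  rewrite -{1}[del]subr0; apply: Phi_increment => //; first exact: ltW.
  by apply: le_trans del1; lra.
have i2 : del * gauss 1 <= Phi (2 * del) - Phi del.
  rewrite -{1}(_ : 2 * del - del = del); last by ring.
  by apply: Phi_increment => //; lra.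
have [] := @std_cdf_lattice 0 del (2 * del) sig0; rewrite ?subr0//; lra.
Qed.

End lattice.

Lemma Phi_continuous_ereal (R : realType) (t : R) :
  {for t, continuous (fun s : R => normal_prob 0 1 `]-oo, s]%classic)}.
Proof.
have -> : (fun s : R => normal_prob 0 1 `]-oo, s]%classic) = EFin \o @Phi R.
  by apply/funext => s /=; rewrite /Phi fineK//; exact: fin_num_measure.
apply: cvg_EFin; first exact: nearW.
have d : derivable (@Phi R) t 1 by have [] := Phi_derive t.
exact/differentiable_continuous/derivable1_diffP.
Qed.

(** * Equivalence of the three conditions, and the order of the normal approximation error *)

Theorem corollary1 (R : realType) (m : nat -> nat)
  (p : forall n, 'I_(m n) -> R)
  (d : nat -> measure_display) (T : forall n, measurableType (d n))
  (P : forall n, probability (T n) R)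
  (X : forall n, 'I_n -> {RV (P n) >-> nat})
  (Y := fun n => non_isolated (X n) : {RV (P n) >-> R})
  (sigmaY := fun n => stddev (P n) (Y n))
  (S := fun n => n%:R ^+ 2 * \sum_(x < m n) p n x ^+ 2)
  (gamma := fun n => Num.max (n%:R * sup (range (p n))) 1)
  (m_ge4 : forall n, (4 <= m n)%N)
  (p_gt0 : forall n x, 0 < p n x)
  (p_sum1 : forall n, \sum_(x < m n) p n x = 1)
  (X_pmf : forall n i (x : 'I_(m n)),
     P n [set w | X n i w = x :> nat] = (p n x)%:E)
  (X_indep : forall n, mutually_independent (X n))
  (gamma_bounded : has_ubound (range gamma)) :
  [/\ S @ \oo --> +oo <-> sigmaY @ \oo --> +oo,
      sigmaY @ \oo --> +oo <->
        cvg_in_distribution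
          (fun n => standardize (P n) (Y n) : {RV (P n) >-> R})
          (normal_prob 0 1)
    & S @ \oo --> +oo ->
        isTheta (fun n => Kolmogorov_dist_normal (Y n)) (fun n => (sigmaY n)^-1)
        /\ isTheta (fun n => (sigmaY n)^-1) (fun n => (Num.sqrt (S n))^-1)].
Proof.
have [g gP] : exists g : R, forall n, gamma n <= g.
  by have [g gP] := gamma_bounded; exists g => n; apply: gP; exists n.
have g_ge1 : 1 <= g by apply: le_trans (gP 0%N); rewrite /gamma le_max lexx orbT.
have p_ge0 n x : 0 <= p n x by exact/ltW/p_gt0.
have p_le1 n x : p n x <= 1.
  by rewrite -(p_sum1 n) (bigD1 x)//= lerDl sumr_ge0.
have lam_le n x : n%:R * p n x <= g.
  apply: le_trans (gP n); rewrite /gamma le_max; apply/orP; left.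
  apply: ler_wpM2l => //; apply: ub_le_sup; last by exists x.
  by exists 1 => _ [y _ <-].
have SE n : S n = intensity n (p n) by [].
pose V n := Var (p n) (@noniso R n _).
have V_ge0 n : 0 <= V n by apply: Var_ge0; exact: p_ge0.
have sigE n : sigmaY n = Num.sqrt (V n).
  exact: (stddev_non_isolated (p_sum1 n) (@X_pmf n) (X_indep n)).
have sig_ge0 n : 0 <= sigmaY n by rewrite sigE sqrtr_ge0.
have sig2 n : sigmaY n ^+ 2 = V n by rewrite sigE sqr_sqrtr.
pose mu n := Ex (p n) (@noniso R n _).
pose F n := std_cdf n (p n) (mu n) (sigmaY n).
have cdfE n t : cdf (standardize (P n) (Y n) : {RV (P n) >-> R}) t = (F n t)%:E.
  rewrite /F /std_cdf sigE.
  exact: (cdf_non_isolated (p_sum1 n) (@X_pmf n) (X_indep n)).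
have PhiE t : (normal_prob 0 1 : probability (measurableTypeR R) R)
    `]-oo, t]%classic = (Phi t)%:E.
  by rewrite /Phi fineK//; exact: fin_num_measure.
have V_le n : V n <= 4 * (1 + g) * S n.
  exact: (Var_noniso_le (p_gt0 n) (p_sum1 n) (lam_le n)).
pose b : R := expR (- (4 * g)); have b_gt0 : 0 < b by exact: expR_gt0.
have large : \forall n \near \oo, (2 <= n)%N /\ forall x, p n x <= 4^-1.
  near=> n; have n4 : 4 * g <= n%:R by near: n; exact: nbhs_infty_ger.
  split; first by rewrite -(ler_nat R); lra.
  move=> x; have := lam_le n x; have n0 : 0 < n%:R :> R by lra.
  rewrite mulrC -ler_pdivlMr// => /le_trans; apply.
  by rewrite ler_pdivrMr//; lra.
have V_ge : \forall n \near \oo, b / 2 * (S n - g ^+ 2) <= V n.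
  near=> n; have [n2 n4] : (2 <= n)%N /\ forall x, p n x <= 4^-1 by near: n.
  exact: (Var_noniso_ge n2 (p_gt0 n) (p_sum1 n) n4 (lam_le n)).
(* Once [S n >= 2 * g ^+ 2], subtracting [g ^+ 2] loses at most half of [S n]. *)
have S_V : \forall n \near \oo, 2 * g ^+ 2 <= S n -> b / 4 * S n <= V n.
  near=> n => Sg; have h : b / 2 * (S n - g ^+ 2) <= V n by near: n.
  apply: le_trans h; have : 0 <= b * (S n - 2 * g ^+ 2).
    by rewrite mulr_ge0 ?subr_ge0// ltW.
  lra.
have S_sig : S @ \oo --> +oo -> sigmaY @ \oo --> +oo.
  move=> /cvgryPge Sy; apply/cvgryPge => A.
  near=> n.
  have S1 : 2 * g ^+ 2 <= S n by near: n; exact: Sy.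
  have S2 : A ^+ 2 / (b / 4) <= S n by near: n; exact: Sy.
  have h : 2 * g ^+ 2 <= S n -> b / 4 * S n <= V n by near: n.
  rewrite sigE; apply: le_trans (ler_norm A) _; rewrite -sqrtr_sqr ler_wsqrtr//.
  apply: le_trans (h S1); rewrite -ler_pdivrMl ?divr_gt0//.
  by rewrite mulrC.
have sig_S : sigmaY @ \oo --> +oo -> S @ \oo --> +oo.
  move=> /cvgryPge sy; apply/cvgryPge => A.
  near=> n.
  (* The added 1 makes [sigmaY n >= 1], so its square dominates the same quantity. *)
  have s1 : 4 * (1 + g) * `|A| + 1 <= sigmaY n by near: n; exact: sy.
  have A0 : 0 <= (1 + g) * `|A| by rewrite mulr_ge0//; lra.
  have s2 : 4 * (1 + g) * `|A| <= sigmaY n ^+ 2 by nra.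
  apply: le_trans (ler_norm A) _.
  have := V_le n; rewrite -sig2 => /(le_trans s2).
  by rewrite ler_pM2l//; lra.
have [A [A0 HA]] := kolmogorov_noniso g.
have K_up : S @ \oo --> +oo -> exists C : R, \forall n \near \oo,
    [/\ 0 < sigmaY n, b / 4 * S n <= V n &
      forall t, `|F n t - Phi t| <= C / sigmaY n].
  (* [S n <= 4 / b * V n] turns [Num.sqrt (S n) / V n] into a multiple of [(sigmaY n)^-1]. *)
  move=> /cvgryPge Sy; exists (A * Num.sqrt (4 / b)); near=> n.
  have S1 : 2 * g ^+ 2 <= S n by near: n; exact: Sy.
  have S2 : 1 <= S n by near: n; exact: Sy.
  have h : 2 * g ^+ 2 <= S n -> b / 4 * S n <= V n by near: n.
  have [n2 n4] : (2 <= n)%N /\ forall x, p n x <= 4^-1 by near: n.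
  have hV := h S1.
  have V_gt0 : 0 < V n.
    by apply: lt_le_trans hV; rewrite mulr_gt0 ?divr_gt0// (lt_le_trans ltr01).
  have sig_gt0 : 0 < sigmaY n by rewrite sigE sqrtr_gt0.
  split=> // t; rewrite /F sigE /std_cdf.
  have p2 x : p n x <= 2^-1 by apply: le_trans (n4 x) _; lra.
  have := HA n _ (p n) (ltnW n2) (p_gt0 n) (p_sum1 n) p2 (lam_le n) V_gt0 t.
  move=> /le_trans; apply; rewrite -/(V n) -sigE -(sig2 n) expr2 invfM mulrA.
  rewrite ler_wpM2r ?invr_ge0// ler_pdivrMr// -mulrA ler_wpM2l// sigE -SE.
  rewrite -sqrtrM ?divr_ge0 ?(ltW b_gt0)//; apply: ler_wsqrtr.
  by rewrite -ler_pdivrMl ?divr_gt0// invf_div.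
split.
- by split.
- split=> [sy t _|cv].
    rewrite PhiE; apply: cvg_EFin.
      by apply: nearW => n; rewrite cdfE.
    have [C HC] := K_up (sig_S sy).
    apply/cvgrPdist_le => e e0; near=> n.
    have [s0 _ hF] : [/\ 0 < sigmaY n, b / 4 * S n <= V n &
      forall t, `|F n t - Phi t| <= C / sigmaY n] by near: n.
    rewrite /= cdfE distrC; apply: le_trans (hF t) _.
    rewrite ler_pdivrMr// mulrC -ler_pdivrMr//.
    by near: n; move/cvgryPge: sy; exact.
  have Fcv t : F n t @[n --> \oo] --> Phi t.
    have := cv t (@Phi_continuous_ereal R t); rewrite PhiE => /fine_cvgP[_].
    by apply: cvg_trans; apply: near_eq_cvg; near=> n; rewrite /= cdfE.
  apply/cvgryPge => B0; pose B := Num.max B0 1.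
  have B1 : 1 <= B by rewrite le_max lexx orbT.
  have BB0 : B0 <= B by rewrite le_max lexx.
  have B_gt0 : 0 < B by apply: lt_le_trans B1.
  (* If [sigmaY n < B], then [2 * del * sigmaY n < 2/3], so [std_cdf_far] applies; with [K] a third
     of [del * gauss 1], its conclusion is contradictory. *)
  pose del := (3 * B)^-1.
  have del0 : 0 < del by rewrite invr_gt0 mulr_gt0.
  have delB : del * B = 3^-1.
    by rewrite /del; field; exact: lt0r_neq0.
  have del1 : del <= 3^-1 by rewrite -delB ler_peMr// ltW.
  pose K := del * gauss 1 / 3.
  have K0 : 0 < K by rewrite !mulr_gt0 ?gauss_gt0.
  have near_pt t : \forall n \near \oo, `|F n t - Phi t| <= K.
    by have /cvgrPdistC_le := Fcv t; exact.
  near=> n; apply: (le_trans BB0); rewrite leNgt; apply/negP => sB.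
  have f0 : `|F n 0 - Phi 0| <= K by near: n; exact: near_pt.
  have f1 : `|F n del - Phi del| <= K by near: n; exact: near_pt.
  have f2 : `|F n (2 * del) - Phi (2 * del)| <= K by near: n; exact: near_pt.
  have gap : 2 * del * sigmaY n < 1.
    have := ltW sB; rewrite -(ler_pM2l del0) delB; lra.
  have := @std_cdf_far R n _ (p n) (mu n) (sigmaY n) K del (sig_ge0 n) del0 _ gap.
  rewrite (_ : 2 * K = 2 / 3 * (del * gauss 1)); last by rewrite /K; field.
  have dg0 : 0 < del * gauss 1 by rewrite mulr_gt0 ?gauss_gt0.
  have d1 : 2 * del <= 1 by lra.
  move=> /(_ d1) H; suff : del * gauss 1 <= 2 / 3 * (del * gauss 1) by lra.
  apply: H => t; rewrite !inE => /or3P[] /eqP -> //.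
- move=> Sy; have [C HC] := K_up Sy.
  have /cvgryPge sy := S_sig Sy.
  split.
    (* [std_cdf_far] with step [(3 * sigmaY n)^-1] gives [gauss 1 / (3 * sigmaY n) <= 2 * D]. *)
    exists (gauss 1 / 6), C; split; first by rewrite divr_gt0 ?gauss_gt0.
    near=> n.
    have [s0 _ hF] : [/\ 0 < sigmaY n, b / 4 * S n <= V n &
      forall t, `|F n t - Phi t| <= C / sigmaY n] by near: n.
    have s1 : 1 <= sigmaY n by near: n; exact: sy.
    pose D := Kolmogorov_dist_normal (Y n).
    have absE t : `| fine (cdf (standardize (P n) (Y n) : {RV (P n) >-> R}) t)
       - fine (normal_prob 0 1 `]-oo, t]%classic) | = `|F n t - Phi t|.
      by rewrite cdfE.
    have D_ub t : `|F n t - Phi t| <= D.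
      rewrite -absE; apply: ub_le_sup; last by exists t.
      by exists (C / sigmaY n) => _ [s _ <-]; rewrite absE.
    have D_le : D <= C / sigmaY n.
      apply: ge_sup; first by exists `|F n 0 - Phi 0|, 0.
      by move=> _ [s _ <-]; rewrite absE.
    rewrite invrK -/D; apply/andP; split; last by rewrite -ler_pdivlMr.
    pose del := (3 * sigmaY n)^-1.
    have del0 : 0 < del by rewrite invr_gt0 mulr_gt0.
    have dels : del * sigmaY n = 3^-1.
      by rewrite /del; field; exact: lt0r_neq0.
    have del1 : del <= 3^-1 by rewrite -dels ler_peMr// ltW.
    have := @std_cdf_far R n _ (p n) (mu n) (sigmaY n) D del (sig_ge0 n) del0.
    have -> : 2 * del <= 1 by lra.
    have -> : 2 * del * sigmaY n < 1 by rewrite -mulrA dels; lra.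
    move=> /(_ isT isT (fun t _ => D_ub t)).
    rewrite -(ler_pM2r s0) mulrAC dels; lra.
  (* The ratio [V n / S n] lies between [b / 4] and [4 * (1 + g)]. As [4 * (1 + g)] and [4 / b + 1]
     are at least 1, their squares dominate [4 * (1 + g)] and [4 / b], so they bound the ratios of
     square roots. *)
  exists (4 * (1 + g))^-1, (4 / b + 1); split; first by rewrite invr_gt0; lra.
  near=> n.
  have [s0 hV _] : [/\ 0 < sigmaY n, b / 4 * S n <= V n &
    forall t, `|F n t - Phi t| <= C / sigmaY n] by near: n.
  have g4 : 1 <= 4 * (1 + g) by lra.
  have g4_ge0 : 0 <= 4 * (1 + g) by lra.
  have b4 : 0 < 4 / b by rewrite divr_gt0.
  have S0 : 0 <= S n.
    by rewrite mulr_ge0 ?sqr_ge0// sumr_ge0// => x _; exact: sqr_ge0.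
  have g4_gt0 : 0 < 4 * (1 + g) by lra.
  rewrite invrK [(sigmaY n)^-1 * _]mulrC ler_pdivlMr// ler_pdivrMr//.
  rewrite ler_pdivrMl//; apply/andP; split; rewrite sigE.
    rewrite -[leRHS]ger0_norm; last by apply: mulr_ge0; rewrite ?sqrtr_ge0.
    rewrite -sqrtr_sqr ler_wsqrtr// exprMn sqr_sqrtr//.
    apply: (le_trans (V_le n)); rewrite ler_wpM2r// expr2 ler_peMr//.
  have b41 : 0 <= 4 / b + 1 by rewrite addr_ge0// ltW.
  rewrite -[leRHS]ger0_norm; last by apply: mulr_ge0; rewrite ?sqrtr_ge0.
  rewrite -sqrtr_sqr ler_wsqrtr// exprMn sqr_sqrtr//.
  apply: (@le_trans _ _ (4 / b * V n)).
    by rewrite -ler_pdivrMl// invf_div.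
  by rewrite ler_wpM2r// expr2; nra.
Unshelve. all: by end_near.
Qed.
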